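(* Let $T>0$, let $X\in C^\infty([0,T],\mathbb R^d)$, let $k\ge 1$, and let $M\in\mathcal L(\mathbb R^d,\mathfrak{so}(k))$. For $\lambda\in\mathbb R$ let $Y^\lambda_{[0,T]}$ be the solution of $$dY^\lambda_t=Y^\lambda_t\,(\lambda M)(\dot X_t)\,dt,\qquad Y^\lambda_0=I_k .$$ Then: (1) For all $t\in[0,T]$, $Y^\lambda_t=\widetilde{\lambda M}(S(X)_{0,t})=\sum_{n=0}^\infty\lambda^nM^{\otimes n}(S(X)^n_{0,t})=\Phi_{X_{[0,t]}}(\lambda M)$. (2) For all $t\in[0,T]$, $Y^\lambda_t\in O(k)$ is an orthogonal matrix. (3) For all $t\in[0,T]$, the mapping $\lambda\mapsto Y^\lambda_t$ is real analytic on $\mathbb R$ and can be extended to a holomorphic function on $\mathbb C$, and the extended function $Y^z_t=\sum_{n=0}^\infty z^nM^{\otimes n}(S(X)^n_{0,t})=\widetilde{zM}(S(X)_{0,t})$, $z\in\mathbb C$, satisfies the linear differential equation $dY^z_t=Y^z_t(zM)(dX_t)$, $Y^z_0=I_k$. Moreover, for any $n\ge 1$ and $\lambda\in\mathbb R$, the $n$-th derivative $Y^{\lambda,(n)}_t:=\frac{\partial^n}{\partial\lambda^n}Y^\lambda_t$ satisfies $$Y^{\lambda,(n)}_t=n!\int_{\Delta^n_t}\mathrm{Ad}_{Y^\lambda_{s_1}}(M(\dot X_{s_1}))\,\mathrm{Ad}_{Y^\lambda_{s_2}}(M(\dot X_{s_2}))\cdots\mathrm{Ad}_{Y^\lambda_{s_n}}(M(\dot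 X_{s_n}))\,ds_1\,ds_2\cdots ds_n\;Y^\lambda_t ,$$ where all concatenations are matrix multiplications.
   Context: $\mathfrak{so}(k)$ is the space of real antisymmetric $k\times k$ matrices, $O(k)$ the orthogonal group, $\mathcal L(V,W)$ the linear maps from $V$ to $W$. $\mathrm{Ad}_A(B)=ABA^{-1}$ for invertible $A$. $\Delta^n_t=\{(s_1,\dots,s_n):0\le s_1<\dots<s_n\le t\}$. The signature of $X$ on $[0,t]$ is $S(X)_{0,t}=(1,S(X)^1_{0,t},S(X)^2_{0,t},\dots)\in\prod_{n\ge0}(\mathbb R^d)^{\otimes n}$ with $S(X)^n_{0,t}=\int_{\Delta^n_t}dX_{s_1}\otimes\cdots\otimes dX_{s_n}$. For linear $M:\mathbb R^d\to\mathbb C^{k\times k}$, $M^{\otimes n}(z_1\otimes\cdots\otimes z_n)=M(z_1)\cdots M(z_n)$, $M^{\otimes0}(1)=I_k$, and $\widetilde M(x)=\sum_{n\ge 0}M^{\otimes n}(x^n)$; the (unitary) development of $X_{[0,t]}$ under $M$ is $\Phi_{X_{[0,t]}}(M)=\widetilde M(S(X)_{0,t})$. Analyticity and holomorphy of matrix-valued functions are meant entrywise. *)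

(* Defs.v *)
From HB Require Import structures.
From mathcomp Require Import all_boot all_order all_algebra.
From mathcomp Require Import complex.
From mathcomp Require Import all_classical all_reals all_analysis.

Set Implicit Arguments.
Unset Strict Implicit.
Unset Printing Implicit Defensive.
Import Order.TTheory GRing.Theory Num.Theory.
Import numFieldNormedType.Exports.
Local Open Scope classical_set_scope.
Local Open Scope ring_scope.
Local Open Scope complex_scope.

(* R[i] carries the topology of its modulus and is a normed space over itself,
   so that 'M[R[i]]_k is a normed space over R[i] and [derivable] for functions
   R[i] -> R[i] is complex differentiability. *)
HB.instance Definition _ (R : rcfType) := NormedModule.copy R[i] R[i]^o.

Notation "\mxprod_ ( x <- s ) F" := (\big[mulmx/1%:M]_(x <- s) F)
  (at level 36, F at level 36, x, s at level 50,
   format "\mxprod_ ( x  <-  s )  F") : ring_scope.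

Section Calculus.
Variable R : realType.

(* Derivative at t, with respect to the real variable, of f restricted to A; it
   is one-sided at an end point of an interval A. The map iota embeds R in the
   scalars K: it is id for K = R and x |-> x%:C for K = R[i]. *)
Definition has_deriv_within (K : numFieldType) (iota : R -> K)
    (V : normedModType K) (A : set R) (f : R -> V) (t : R) (l : V) : Prop :=
  iota (s - t)^-1 *: (f s - f t) @[s --> within A t^'] --> l.

Definition deriv_within (V : normedModType R) (A : set R) (f : R -> V) (t : R)
    : V :=
  lim ((s - t)^-1 *: (f s - f t) @[s --> within A t^']).

Definition smooth_on (V : normedModType R) (A : set R) (f : R -> V) : Prop :=
  forall (n : nat) (t : R), A t ->
    exists l, has_deriv_within id A (iter n (deriv_within A) f) t l.

Definition real_analytic (f : R -> R) : Prop :=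
  forall x0 : R, exists r : R, 0 < r /\
    exists a : nat -> R, forall x : R, `|x - x0| < r ->
      series (fun n => a n * (x - x0) ^+ n) @ \oo --> f x.

Definition holomorphic (f : R[i] -> R[i]) : Prop :=
  forall z : R[i], derivable f z 1.

(* The integral of F over Delta^n_t = {0 <= s_1 < ... < s_n <= t}, as the
   iterated integral int_0^t (... int_0^{s_2} F ds_1 ...) ds_n; the outermost
   variable s_n is the last component of the tuple. *)
Fixpoint simplex_int (n : nat) (t : R) : (n.-tuple R -> R) -> R :=
  match n with
  | 0 => fun F => F [tuple]
  | m.+1 => fun F =>
      \int[lebesgue_measure]_(s in `[0, t])
        simplex_int s (fun u : m.-tuple R => F [tuple of rcons u s])
  end.

Definition simplex_int_mx (k n : nat) (t : R) (F : n.-tuple R -> 'M[R]_k)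
    : 'M[R]_k :=
  \matrix_(i, j) simplex_int t (fun s => F s i j).

End Calculus.

Definition so_mx (R : realType) (k : nat) (A : 'M[R]_k) : Prop := A^T = - A.

Definition orthogonal_mx (R : realType) (k : nat) (A : 'M[R]_k) : Prop :=
  A^T *m A = 1%:M.

Definition Ad (R : realType) (k : nat) (A B : 'M[R]_k) : 'M[R]_k :=
  A *m B *m invmx A.

Section Tensors.
Variables (R : realType) (d : nat).

(* An element of (R^d)^{(x) n}, given by its coordinates in the basis
   e_{i_1} (x) ... (x) e_{i_n}. *)
Definition tensor (n : nat) : Type := {ffun n.-tuple 'I_d -> R}.

Definition pure_tensor (n : nat) (z : n.-tuple 'rV[R]_d) : tensor n :=
  [ffun I : n.-tuple 'I_d => \prod_(j < n) tnth z j 0 (tnth I j)].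

Definition tensor_seq : Type := forall n : nat, tensor n.

Section Development.
Variables (k : nat) (M : 'rV[R]_d -> 'M[R[i]]_k).

(* M^{(x) n}, as the linear extension of its values on the basis; M is meant to
   be R-linear, see tensor_map_pure. *)
Definition tensor_map (n : nat) (x : tensor n) : 'M[R[i]]_k :=
  \sum_(I : n.-tuple 'I_d)
    (x I)%:C *: \mxprod_(a <- I) M (delta_mx 0 a).

(* M~, meaningful when the series converges. *)
Definition tilde (x : tensor_seq) : 'M[R[i]]_k :=
  lim (series (fun n => tensor_map (x n)) @ \oo).

End Development.

(* S(X)_{0,t} for X smooth on [0, T], with dX_s = X'_s ds. *)
Definition signature (T : R) (X : R -> 'rV[R]_d) (t : R) : tensor_seq :=
  fun n => [ffun I : n.-tuple 'I_d => simplex_int t (fun s : n.-tuple R =>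
    pure_tensor [tuple of map (deriv_within `[0, T] X) s] I)].

Definition development (T : R) (X : R -> 'rV[R]_d) (t : R) (k : nat)
    (M : 'rV[R]_d -> 'M[R[i]]_k) : 'M[R[i]]_k :=
  tilde M (signature T X t).

End Tensors.

Definition cplx_mx (R : realType) (m n : nat) (A : 'M[R]_(m, n))
    : 'M[R[i]]_(m, n) :=
  map_mx (real_complex R) A.

Lemma tensor_map_pure (R : realType) (d k n : nat)
    (M : 'rV[R]_d -> 'M[R[i]]_k)
    (M_lin : forall a u v, M (a *: u + v) = a%:C *: M u + M v)
    (z : n.-tuple 'rV[R]_d) :
  tensor_map M (pure_tensor z) = \mxprod_(v <- z) M v.
Proof.
have M0 : M 0 = 0.
  have := M_lin 1 0 0; rewrite scaler0 addr0 scale1r => h.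
  by apply: (addrI (M 0)); rewrite addr0 -h.
have MD : {morph M : u v / u + v}.
  by move=> u v; rewrite -[u in LHS]scale1r M_lin scale1r.
have ME (v : 'rV[R]_d) : M v = \sum_a (v 0 a)%:C *: M (delta_mx 0 a).
  rewrite [in LHS](row_sum_delta v) (big_morph M MD M0).
  by apply: eq_bigr => a _; rewrite -[X in M X]addr0 M_lin M0 addr0.
elim: n z => [|n IHn] z.
  rewrite /tensor_map (tuple0 z) /= big_nil.
  rewrite (big_pred1 [tuple]) => [|I]; last by rewrite [I]tuple0.
  by rewrite big_nil ffunE big_ord0 scale1r.
case/tupleP: z => v z; rewrite big_cons -IHn ME mulmx_suml.
rewrite /tensor_map.
rewrite (reindex (fun p : 'I_d * n.-tuple 'I_d => [tuple of p.1 :: p.2])) /=.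
  rewrite -(pair_bigA _ (fun (a : 'I_d) (I : n.-tuple 'I_d) => (pure_tensor [tuple of v :: z]
     [tuple of a :: I])%:C *: \mxprod_(b <- a :: I) M (delta_mx 0 b))) /=.
  apply: eq_bigr => a _; rewrite mulmx_sumr; apply: eq_bigr => I _.
  rewrite big_cons -scalemxAl -scalemxAr scalerA; congr (_ *: _).
  rewrite !ffunE big_ord_recl !tnth0 -rmorphM; congr (_ * _)%:C.
  by apply: eq_bigr => j _; rewrite !tnthS.
exists (fun I : n.+1.-tuple 'I_d => (thead I, [tuple of behead I])).
  by move=> [a I] _ /=; congr (_, _); apply: val_inj.
by move=> I _ /=; rewrite -tuple_eta.
Qed.

(* Main.v *)
(* A solution of Z' = mu Z B with Z_0 = 1 is the sum over n of mu^n P_n, where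
   P_n is the n-fold iterated integral of B: the remainder after N terms is
   obtained by integrating the previous one against mu B, so it is at most
   K (|mu| C t)^N / N!. For B = M(X') this gives the signature series, and the
   same bounds make the complex series an entire function of z that solves the
   complex equation. Since B is antisymmetric, Y^mu (Y^lam)^T has derivative
   (mu - lam) Y^mu B (Y^lam)^T; for mu = lam it is constant, so Y^lam is
   orthogonal, and then Z = Y^mu (Y^lam)^T solves
   Z' = (mu - lam) Z Ad_{Y^lam}(B). Its iterated-integral series is the Taylor
   expansion of Y^mu at lam, from which analyticity and the derivatives at lam
   are read off. *)

Require Import Defs.
From HB Require Import structures.
From mathcomp Require Import all_boot all_order all_algebra.
From mathcomp Require Import complex.
From mathcomp Require Import all_classical all_reals all_analysis.
From mathcomp Require Import ring lra.

Set Implicit Arguments.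
Unset Strict Implicit.
Unset Printing Implicit Defensive.
Import Order.TTheory GRing.Theory Num.Theory.
Import numFieldNormedType.Exports.
Local Open Scope classical_set_scope.
Local Open Scope ring_scope.
Local Open Scope complex_scope.

(** [Y] is given, so no solution has to be constructed over the reals: the remainder estimate
    identifies any solution with its series, and the same lemma serves for the driver [M X'] and for
    its conjugate by [Y lam]. Antisymmetry makes the transpose of [Y lam] its inverse, and a
    transpose is differentiated at once. The equations live on a closed interval, with one-sided
    derivatives at its ends. The calculus is therefore rebuilt for derivatives within [[0, T]]
    around one tool, a mean value inequality. Iterated integrals are handled through their
    derivative and their value at 0, and identities between them follow by comparing these two.
    Matrices are treated entry by entry. Since the P_n are real, the real and imaginary parts of the
    complex series are real series with coefficients Re z^n and Im z^n. This is why sums of c_n P_n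
    are studied for general real c: differentiation in t never leaves the reals. Complex analysis is
    needed in z alone, where one termwise differentiation lemma over an arbitrary scalar field
    covers both d/dlam and d/dz. *)

(** * Entrywise limits of matrices and complex numbers *)

Lemma cvg_mxP (K : numFieldType) (U : Type) (F : set_system U) (m n : nat)
    (f : U -> 'M[K]_(m, n)) (l : 'M[K]_(m, n)) : Filter F ->
  f x @[x --> F] --> l <-> forall i j, f x i j @[x --> F] --> l i j.
Proof.
move=> FF; split=> [fl i j|fl].
  exact: (cvg_comp _ _ fl (@coord_continuous K m n i j l)).
apply/cvg_mx_entourageP => A entA.
apply: filter_forall => i; apply: filter_forall => j.
by have /cvg_app_entourageP/(_ _ entA) := fl i j; apply: filterS => x /mem_set.
Qed.

Lemma cvg_real_complex (R : realType) (U : Type) (F : set_system U)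
    (f : U -> R) (l : R) : Filter F ->
  f x @[x --> F] --> l -> (f x)%:C @[x --> F] --> (l%:C : R[i]).
Proof.
move=> FF /cvgrPdist_le fl; apply/cvgrPdist_le => -[e e'].
rewrite ltcE/= => /andP[/eqP -> e0].
near=> x; rewrite -rmorphB normc_def/= expr0n addr0 sqrtr_sqr lecR.
by near: x; exact: fl.
Unshelve. all: by end_near. Qed.

Lemma cvg_complex (R : realType) (U : Type) (F : set_system U)
    (f g : U -> R) (a b : R) : Filter F ->
  f x @[x --> F] --> a -> g x @[x --> F] --> b ->
  (f x +i* g x) @[x --> F] --> (a +i* b : R[i]).
Proof.
move=> FF fa gb.
have E x y : (x +i* y : R[i]) = x%:C + 'i * y%:C.
  by apply/eqP; rewrite eq_complex/=; apply/andP; split; apply/eqP; ring.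
under eq_cvg do rewrite E; rewrite E.
by apply: cvgD; [|apply: cvgMl_tmp]; exact: cvg_real_complex.
Qed.

(** * Differential and integral calculus relative to the interval [0, T] *)

Section DerivWithin.
Variables (R : realType) (T : R).
Implicit Types (f g : R -> R) (t l : R).

Local Notation A := `[0, T]%classic.
Definition cont_on f := forall t, A t -> f s @[s --> within A (nbhs t)] --> f t.
Notation dw := (@has_deriv_within R R id R `[0, T]).

(** The division-free form also covers s = t, so estimates need no case distinction on the punctured
    neighbourhood. *)
Lemma has_deriv_withinP f t l : dw f t l <-> forall e, 0 < e ->
  \forall s \near t, A s -> `|f s - f t - (s - t) * l| <= e * `|s - t|.
Proof.
split=> [/cvgrPdist_le h e e0|h].
  have := h _ e0; rewrite near_withinE /dnbhs near_withinE.
  apply: filterS => s hs As.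
  have [->|st] := eqVneq s t; first by rewrite !subrr mul0r subrr normr0 mulr0.
  have st0 : s - t != 0 by rewrite subr_eq0.
  have := hs st As; rewrite distrC.
  rewrite -(ler_pM2r (x := `|s - t|)) ?normr_gt0// -normrM.
  congr (_ <= _); congr `|_|.
  by rewrite /GRing.scale/=; field.
apply/cvgrPdist_le => e e0.
rewrite near_withinE /dnbhs near_withinE.
apply: filterS (h _ e0) => s hs st As.
have st0 : s - t != 0 by rewrite subr_eq0.
rewrite distrC -(ler_pM2r (x := `|s - t|)) ?normr_gt0// -normrM.
apply: le_trans (hs As); rewrite le_eqVlt; apply/orP; left; apply/eqP.
by congr `|_|; rewrite /GRing.scale/=; field.
Qed.

Lemma cont_onP f : cont_on f <-> {within A, continuous f}.
Proof. by split=> /subspace_continuousP. Qed.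

Lemma has_deriv_within_cont f t l : dw f t l ->
  f s @[s --> within A (nbhs t)] --> f t.
Proof.
move=> /has_deriv_withinP/(_ 1 ltr01) h; apply/cvgrPdist_le => e e0.
rewrite near_withinE.
have k0 : 0 < e / (1 + `|l|) by rewrite divr_gt0// ltr_pwDl.
near=> s => As; rewrite distrC.
have -> : f s - f t = f s - f t - (s - t) * l + (s - t) * l by rewrite subrK.
apply: le_trans (ler_normD _ _) _.
have hs : `|f s - f t - (s - t) * l| <= 1 * `|s - t| by move: As; near: s.
have st : `|s - t| <= e / (1 + `|l|).
  by rewrite distrC; near: s; apply: cvgr_dist_le => //; exact: cvg_id.
rewrite normrM (le_trans (lerD hs (lexx _)))// mul1r -[X in X + _]mulr1 -mulrDr.
by rewrite -ler_pdivlMr// ltr_pwDl.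
Unshelve. all: by end_near. Qed.

Lemma deriv_cont_on f f' : (forall t, A t -> dw f t (f' t)) -> cont_on f.
Proof. by move=> h t At; exact: has_deriv_within_cont (h t At). Qed.

Lemma eq_cont_on f g : {in A, f =1 g} -> cont_on f -> cont_on g.
Proof.
move=> fg /cont_onP cf; apply/cont_onP.
exact: subspace_eq_continuous fg cf.
Qed.

Lemma has_deriv_within_cst c t : dw (cst c) t 0.
Proof.
apply/has_deriv_withinP => e e0; near=> s => _.
by rewrite subrr mulr0 subr0 normr0 mulr_ge0// ltW.
Unshelve. all: by end_near. Qed.

Lemma has_deriv_withinD f g t l m : dw f t l -> dw g t m ->
  dw (fun s => f s + g s) t (l + m).
Proof.
move=> fl gm; rewrite /has_deriv_within.
have -> : (fun s => id (s - t)^-1 *: (f s + g s - (f t + g t))) =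
  (fun s => id (s - t)^-1 *: (f s - f t) + id (s - t)^-1 *: (g s - g t)).
  by apply/funext => s; rewrite -scalerDr opprD addrACA.
exact: cvgD.
Qed.

Lemma has_deriv_withinM f g t l m : dw f t l -> dw g t m ->
  dw (fun s => f s * g s) t (l * g t + f t * m).
Proof.
move=> fl gm; rewrite /has_deriv_within.
have -> : (fun s => id (s - t)^-1 *: (f s * g s - f t * g t)) =
  (fun s => (id (s - t)^-1 *: (f s - f t)) * g s +
            f t * (id (s - t)^-1 *: (g s - g t))).
  by apply/funext => s; rewrite /GRing.scale/=; ring.
apply: cvgD; last by apply: cvgMl_tmp.
(* Continuity of [g] is along full neighbourhoods of t in [0, T], the quotient along punctured ones;
   the latter filter is finer. *)
apply: cvgM => //; apply: cvg_trans (has_deriv_within_cont gm).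
apply: cvg_app => P.
have -> : nbhs (within A (nbhs t)) P = \forall x \near t, A x -> P x by [].
have -> : nbhs (within A t^') P = \forall x \near t, x != t -> A x -> P x by [].
by apply: filterS => s h _.
Qed.

Lemma has_deriv_withinZ c f t l : dw f t l -> dw (fun s => c * f s) t (c * l).
Proof.
move=> fl; have := has_deriv_withinM (has_deriv_within_cst c t) fl.
by rewrite mul0r add0r.
Qed.

Lemma has_deriv_within_sum (I : Type) (r : seq I) (P : pred I)
    (f : I -> R -> R) (l : I -> R) t :
  (forall i, dw (f i) t (l i)) ->
  dw (fun s => \sum_(i <- r | P i) f i s) t (\sum_(i <- r | P i) l i).
Proof.
move=> fl; elim: r => [|i r IH].
  have -> : (fun s => \sum_(i <- [::] | P i) f i s) = cst 0.
    by apply/funext => s; rewrite big_nil.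
  rewrite big_nil; exact: has_deriv_within_cst.
have -> : (fun s => \sum_(j <- i :: r | P j) f j s) =
    (fun s => if P i then f i s + \sum_(j <- r | P j) f j s
              else \sum_(j <- r | P j) f j s).
  by apply/funext => s; rewrite big_cons.
by rewrite big_cons; case: ifP => // _; exact: has_deriv_withinD.
Qed.

Lemma has_deriv_within_id t : dw id t 1.
Proof.
apply/has_deriv_withinP => e e0; near=> s => _.
by rewrite mulr1 subrr normr0 mulr_ge0// ltW.
Unshelve. all: by end_near. Qed.

Lemma has_deriv_within_exp n t : dw (fun s => s ^+ n.+1) t (n.+1%:R * t ^+ n).
Proof.
elim: n => [|n IH].
  have -> : (fun s : R => s ^+ 1) = id by apply/funext => s; rewrite expr1.
  by rewrite expr0 mulr1; exact: has_deriv_within_id.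
have -> : (fun s : R => s ^+ n.+2) = (fun s => s ^+ n.+1 * s).
  by apply/funext => s; rewrite exprSr.
have -> : n.+2%:R * t ^+ n.+1 = n.+1%:R * t ^+ n * t + t ^+ n.+1 * 1.
  by rewrite -mulrA -exprSr mulr1 -{3}[t ^+ _]mul1r -mulrDl natr1.
exact: has_deriv_withinM (has_deriv_within_id t).
Qed.

(** At interior points the restriction to [0, T] is invisible, which gives access to the ordinary
    mean value theorem. *)
Lemma has_deriv_within_interior f t l :
  t \in `]0, T[%R -> dw f t l -> is_derive t 1 f l.
Proof.
move=> t0T /has_deriv_withinP h.
suff H : (fun h => h^-1 *: ((f \o shift t) (h *: 1) - f t)) @ 0^' --> l.
  split; first by apply/cvg_ex; exists l.
  exact/cvg_lim.
apply/cvgrPdist_le => e e0.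
have : \forall s \near t, `|f s - f t - (s - t) * l| <= e * `|s - t|.
  apply: filterS2 (h _ e0) (near_in_itvoo t0T) => s + sT; apply.
  by move: sT; rewrite /= !in_itv/= => /andP[s0 s1]; rewrite !ltW.
rewrite (near_shift 0) => {}h; rewrite /dnbhs near_withinE.
apply: filterS h => s /=; rewrite subr0 => hs s0.
rewrite distrC -(ler_pM2r (x := `|s|)) ?normr_gt0// -normrM.
move: hs; rewrite addrK.
congr (_ <= _); congr `|_|; rewrite /GRing.scale/= mulr1.
by field.
Qed.

(** The mean value theorem asks for derivatives on the open interval only; the end points enter
    through continuity. *)
Lemma ge0_has_deriv_within_le f f' x y : (forall t, A t -> dw f t (f' t)) ->
  (forall t, A t -> x <= t <= y -> 0 <= f' t) -> 0 <= x -> x <= y -> y <= T ->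
    f x <= f y.
Proof.
move=> df f'0 x0 xy yT.
have sub : `[x, y] `<=` A.
  by move=> z /=; rewrite !in_itv/= => /andP[? ?]; apply/andP; split; lra.
have [||c] := @MVT_segment R f f' x y xy.
- move=> t; rewrite in_itv/= => /andP[xt ty]; apply: has_deriv_within_interior.
    by rewrite in_itv/=; apply/andP; split; lra.
  by apply: df; rewrite /= in_itv/=; apply/andP; split; lra.
- by apply: continuous_subspaceW sub _; apply/cont_onP; exact: deriv_cont_on df.
- rewrite in_itv/= => cxy E; rewrite -subr_ge0 E mulr_ge0 ?subr_ge0//.
  by apply: f'0 => //; apply: sub; rewrite /= in_itv.
Qed.

(** Both [g + f] and [g - f] have nonnegative derivative on [x, y]. This mean value inequality
    carries the later estimates, in place of bounds on integrals. *)
Lemma le_norm_has_deriv_within f f' g g' x y :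
  (forall t, A t -> dw f t (f' t)) -> (forall t, A t -> dw g t (g' t)) ->
  (forall t, A t -> x <= t <= y -> `|f' t| <= g' t) -> 0 <= x -> x <= y ->
    y <= T ->
  `|f y - f x| <= g y - g x.
Proof.
move=> df dg fg x0 xy yT; rewrite ler_norml; apply/andP; split.
  have := @ge0_has_deriv_within_le (fun s => g s + f s)
    (fun s => g' s + f' s) x y.
  rewrite lerNl => H.
  suff : g x + f x <= g y + f y by lra.
  apply: H => // [t At|t At /(fg t At)]; first by apply: has_deriv_withinD;
    auto.
  by rewrite ler_norml => /andP[]; lra.
have := @ge0_has_deriv_within_le (fun s => g s + -1 * f s)
  (fun s => g' s + -1 * f' s) x y.
move=> H; suff : g x + - 1 * f x <= g y + -1 * f y by lra.
apply: H => // [t At|t At /(fg t At)].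
  by apply: has_deriv_withinD; auto; apply: has_deriv_withinZ; auto.
by rewrite ler_norml => /andP[]; lra.
Qed.

(** The mean value inequality for the difference, with a zero majorant. It is the uniqueness
    principle behind the identities between iterated integrals. *)
Lemma eq_has_deriv_within0 f g f' t : 0 <= T ->
  (forall t, A t -> dw f t (f' t)) -> (forall t, A t -> dw g t (f' t)) ->
  f 0 = g 0 -> A t -> f t = g t.
Proof.
move=> T0 df dg fg0; rewrite /= in_itv/= => /andP[t0 tT].
have /(_ (cst 0) (cst 0) 0 t) := @le_norm_has_deriv_within
  (fun s => f s + -1 * g s) (fun s => f' s + -1 * f' s).
rewrite /= subrr => H; suff : `|f t + -1 * g t - (f 0 + -1 * g 0)| <= 0.
  by rewrite normr_le0 fg0 => /eqP; lra.
apply: H => // [s As|s As|s As _].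
- by apply: has_deriv_withinD; auto; apply: has_deriv_withinZ; auto.
- exact: has_deriv_within_cst.
- by rewrite mulN1r subrr normr0.
Qed.

Lemma cont_onM (f g : R -> R) : cont_on f -> cont_on g ->
  cont_on (fun t => f t * g t).
Proof. by move=> cf cg t At; apply: cvgM; [exact: cf|exact: cg]. Qed.

Lemma cont_on_sum (I : Type) (r : seq I) (f : I -> R -> R) :
  (forall i, cont_on (f i)) -> cont_on (fun t => \sum_(i <- r) f i t).
Proof.
move=> cf t At.
have -> : (fun s => \sum_(i <- r) f i s) = (\sum_(i <- r) f i).
  by apply/funext => s; rewrite fct_sumE.
rewrite -[X in _ --> X]/((fun s => \sum_(i <- r) f i s) t) -fct_sumE.
elim: r => [|i r IH]; first by rewrite big_nil; exact: cvg_cst.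
by rewrite big_cons; apply: cvgD; [exact: cf|exact: IH].
Qed.

Lemma cont_on_mulmx (m n p : nat) (f : R -> 'M[R]_(m, n))
    (g : R -> 'M[R]_(n, p)) :
  (forall i j, cont_on (fun t => f t i j)) ->
    (forall i j, cont_on (fun t => g t i j)) ->
  forall i j, cont_on (fun t => (f t *m g t) i j).
Proof.
move=> cf cg i j.
have -> : (fun t => (f t *m g t) i j) = (fun t => \sum_l f t i l * g t l j).
  by apply/funext => t; rewrite mxE.
by apply: cont_on_sum => l; exact: cont_onM.
Qed.

Lemma cont_on_bounded f : 0 <= T -> cont_on f ->
  exists2 C, 0 <= C & forall t, A t -> `|f t| <= C.
Proof.
move=> T0 /cont_onP cf.
have cg : {within A, continuous (fun t => `|f t|)}.
  move=> x; apply: (continuous_comp (cf x)); exact: norm_continuous.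
have [c cA hc] := EVT_max T0 cg.
by exists `|f c| => // t At; apply: hc.
Qed.

Lemma cont_on_integrable f x y : 0 <= x -> y <= T -> cont_on f ->
  lebesgue_measure.-integrable `[x, y] (EFin \o f).
Proof.
move=> x0 yT /cont_onP cf; apply: continuous_compact_integrable;
  first exact: segment_compact.
apply: continuous_subspaceW cf => s; rewrite /= !in_itv/= => /andP[? ?].
by apply/andP; split; lra.
Qed.

(** The fundamental theorem of calculus up to both end points: near t the integrand stays within e
    of the constant [f t]. *)
Lemma Rintegral_has_deriv_within f t : cont_on f -> A t ->
  dw (fun t => \int[lebesgue_measure]_(s in `[0, t]) f s) t (f t).
Proof.
move=> cf At; have := At; rewrite /= in_itv/= => /andP[t0 tT].
apply/has_deriv_withinP => e e0.
have /cvgrPdist_le/(_ _ e0) := cf t At;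
  rewrite near_withinE => /nbhs_ballP[d d0 hd].
(* Stated for an ordered pair near t, so that one estimate serves s on either side of t. *)
have E x y : 0 <= x -> x <= y -> y <= T -> `|t - x| < d -> `|t - y| < d ->
  `|\int[lebesgue_measure]_(s in `[0, y]) f s -
    \int[lebesgue_measure]_(s in `[0, x]) f s - (y - x) * f t| <= e * (y - x).
  move=> x0 xy yT txd tyd.
  rewrite Rintegral_itvB; [|exact: cont_on_integrable|
    by rewrite bnd_simp|by rewrite bnd_simp].
  have If : lebesgue_measure.-integrable `[x, y] (EFin \o f)
    by exact: cont_on_integrable.
  have Ic c : lebesgue_measure.-integrable `[x, y] (EFin \o cst c : R ->
    \bar R).
    by apply: cont_on_integrable => // s As; exact: cvg_cst.
  rewrite Rintegral_itv_obnd_cbnd; last first.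
    by apply: integrableS If => //; apply: subset_itv; rewrite bnd_simp.
  have int_cst c : \int[lebesgue_measure]_(s in `[x, y]) cst c s = c * (y - x).
    rewrite Rintegral_cst//= lebesgue_measure_itv/= lte_fin.
    by have [->|xy'] := eqVneq x y; rewrite ?ltxx ?subrr// lt_neqAle xy' xy.
  rewrite (mulrC (y - x)) -int_cst -RintegralB// -int_cst.
  apply: le_trans (le_normr_Rintegral _ _) _ => //.
    exact: (integrableB _ If (Ic (f t))).
  apply: le_Rintegral => //.
    apply/integrable_norm; exact: (integrableB _ If (Ic (f t))).
  move=> s; rewrite /= in_itv/= => /andP[xs sy].
  rewrite distrC; apply: hd => /=; last by rewrite in_itv/=; apply/andP; split;
    lra.
  move: txd tyd; rewrite /ball/= !ltr_norml => /andP[? ?] /andP[? ?].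
  by apply/andP; split; lra.
exists d => // s /= sd; rewrite in_itv/= => /andP[s0 sT].
have [ts|/ltW st] := leP t s.
  by rewrite (ger0_norm (x := s - t)) ?subr_ge0//; apply: E => //;
    rewrite subrr normr0.
rewrite distrC (distrC s) (ger0_norm (x := t - s)) ?subr_ge0//.
have := E s t s0 st tT sd; rewrite subrr normr0 => /(_ d0); congr (_ <= _).
by congr `|_|; ring.
Qed.

End DerivWithin.

(** * Dominated series and uniform limits *)

(** The error is bounded by the tail of the majorant, hence uniformly in any parameter on which [v]
    does not depend. *)
Lemma dominated_series (R : realType) (u v : R^nat) (V : R) :
  (forall n, `|u n| <= v n) -> series v @ \oo --> V ->
  cvgn (series u) /\
  forall N, `|limn (series u) - series u N| <= V - series v N.
Proof.
move=> uv vV; have v0 n : 0 <= v n by apply: le_trans (uv n).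
have cu : cvgn (series u).
  apply: normed_cvg; apply: series_le_cvg uv _ => //.
  by apply/cvg_ex; exists V.
split=> // N.
have h : `|series u n - series u N| @[n --> \oo] -->
    `|limn (series u) - series u N|.
  by apply: cvg_norm; apply: cvgB => //; exact: cvg_cst.
have h' : series v n - series v N @[n --> \oo] --> V - series v N.
  by apply: cvgB => //; exact: cvg_cst.
apply: ler_cvg_to h h' _; near=> n.
rewrite !sub_series_geq; [|by near: n; exact: nbhs_infty_ge..].
by apply: le_trans (ler_norm_sum _ _ _) _; exact: ler_sum.
Unshelve. all: by end_near. Qed.

Lemma cvg_scaled_exp_series (R : realType) (K x : R) :
  series (fun n => K * exp_coeff x n) @ \oo --> K * expR x.
Proof.
have -> : series (fun n => K * exp_coeff x n) =
  (fun N => K * series (exp_coeff x) N).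
  by apply/funext => N; rewrite /series/= mulr_sumr.
by apply: cvgMl_tmp; exact: is_cvg_series_exp_coeff.
Qed.

Section Limits.
Variables (R : realType) (T : R).
Local Notation A := `[0, T]%classic.
Local Notation dw := (@has_deriv_within R R id R `[0, T]).
Variables (f g : R -> R) (fN gN : nat -> R -> R) (e : R^nat).
Hypothesis e0 : e @ \oo --> (0 : R).
Hypothesis gNg : forall N t, A t -> `|g t - gN N t| <= e N.

Lemma uniform_limit_cont_on : (forall N, cont_on T (gN N)) -> cont_on T g.
Proof.
move=> cg t At; apply/cvgrPdist_le => d d0.
have d3 : 0 < d / 3 by rewrite divr_gt0.
have /cvgr0_norm_le/(_ _ d3)[N _ /(_ N (leqnn _))/= eN] := e0.
have /cvgrPdist_le/(_ _ d3) := cg N t At; rewrite !near_withinE.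
apply: filterS => s + As => /(_ As).
have := gNg N At; have := gNg N As; move: eN; rewrite !ler_norml.
move=> /andP[? ?] /andP[? ?] /andP[? ?] /andP[? ?].
by apply/andP; split; lra.
Qed.

(** Only the derivatives must converge uniformly: the mean value inequality, applied before the
    limit, transfers their closeness to increments, and pointwise convergence of [fN] then
    suffices. *)
Lemma uniform_limit_has_deriv_within t :
  (forall t, A t -> fN N t @[N --> \oo] --> f t) ->
  (forall N, cont_on T (gN N)) ->
  (forall N t, A t -> dw (fN N) t (gN N t)) -> A t -> dw f t (g t).
Proof.
move=> fNf cg dfN At; apply/has_deriv_withinP => d d0.
have d2 : 0 < d / 2 by rewrite divr_gt0.
have /cvgrPdist_le/(_ _ d2) := uniform_limit_cont_on cg At.
rewrite near_withinE => /nbhs_ballP[r r0 hr].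
exists r => // s /= sr As.
have /cvgr0_norm_le/(_ _ d2)[N0 _ /= eN] := e0.
have H x y N : A x -> A y -> x <= y -> `|t - x| < r -> `|t - y| < r ->
  (N0 <= N)%N ->
    `|fN N y - fN N x - (y - x) * g t| <= d * (y - x).
  move=> Ax Ay xy txr tyr N0N.
  (* The derivative of [fN N s - g t * s] is within d/2 of [g s - g t] by uniformity, and this is at
     most d/2 by continuity of [g]; the comparison function is d s. *)
  have := @le_norm_has_deriv_within R T (fun s => fN N s + - g t * s)
    (fun s => gN N s + - g t * 1) (fun s => d * s) (fun s => d * 1) x y.
  have -> : fN N y + - g t * y - (fN N x + - g t * x) =
    fN N y - fN N x - (y - x) * g t by ring.
  rewrite -mulrBr; move: (Ax) (Ay);
    rewrite /= !in_itv/= => /andP[? ?] /andP[? ?].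
  apply=> //.
  - move=> u Au; apply: has_deriv_withinD; first exact: dfN.
    exact: has_deriv_withinZ (has_deriv_within_id _ _).
  - move=> u Au; exact: has_deriv_withinZ (has_deriv_within_id _ _).
  move=> u Au /andP[xu uy].
  have := gNg N Au; have := eN N N0N; have := hr u _ Au.
  have tur : ball t r u.
    rewrite /ball/=; move: txr tyr; rewrite !ltr_norml => /andP[? ?] /andP[? ?].
    by apply/andP; split; lra.
  move=> /(_ tur); rewrite !ler_norml.
  move=> /andP[? ?] /andP[? ?] /andP[? ?]; apply/andP; split; lra.
have L x y : A x -> A y ->
    `|fN N y - fN N x - (y - x) * g t| @[N --> \oo]
      --> `|f y - f x - (y - x) * g t|.
  move=> Ax Ay; apply: cvg_norm; apply: cvgB; last exact: cvg_cst.
  by apply: cvgB; exact: fNf.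
have [ts|/ltW st] := leP t s.
  rewrite (ger0_norm (x := s - t)) ?subr_ge0//.
  apply: cvgr_to_le (L _ _ At As) _; exists N0 => // N /= N0N.
  by apply: H => //; rewrite subrr normr0.
rewrite (distrC s) (ger0_norm (x := t - s)) ?subr_ge0//.
have -> : `|f s - f t - (s - t) * g t| = `|f t - f s - (t - s) * g t|.
  by rewrite -normrN; congr `|_|; ring.
apply: cvgr_to_le (L _ _ As At) _; exists N0 => // N /= N0N.
by apply: H => //; rewrite subrr normr0.
Qed.

End Limits.

(** * Iterated integrals of a matrix path and the series built on them *)

Section Picard.
Variables (R : realType) (T : R) (k : nat) (B : R -> 'M[R]_k).
Hypothesis T0 : 0 <= T.
Local Notation A := `[0, T]%classic.
Local Notation dw := (@has_deriv_within R R id R `[0, T]).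

(** These are the P_n. Multiplication on the right follows Z' = Z B and makes the outermost variable
    the last factor. *)
Fixpoint picard (n : nat) (t : R) : 'M[R]_k :=
  if n is m.+1 then
    \matrix_(i, j) \int[lebesgue_measure]_(s in `[0, t]) (picard m s *m B s) i j
  else 1%:M.

Lemma picard0 n : picard n 0 = if n is 0 then 1%:M else 0.
Proof.
case: n => // n; apply/matrixP => i j; rewrite !mxE.
by rewrite set_itv1 Rintegral_set1.
Qed.

Hypothesis cB : forall i j, cont_on T (fun t => B t i j).

Lemma picard_cont n i j : cont_on T (fun t => picard n t i j).
Proof.
elim: n i j => [|n IH] i j /=; first by move=> t _; exact: cvg_cst.
apply: (@deriv_cont_on _ _ _ (fun t => (picard n t *m B t) i j)) => t At.
have -> : (fun t => (\matrix_(i, j) \int[lebesgue_measure]_(s in `[0, t])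
  (picard n s *m B s) i j) i j) =
  (fun t => \int[lebesgue_measure]_(s in `[0, t]) (picard n s *m B s) i j).
  by apply/funext => s; rewrite mxE.
by apply: Rintegral_has_deriv_within => //; apply: cont_on_mulmx.
Qed.

Lemma picardS_has_deriv_within n t i j : A t ->
  dw (fun t => picard n.+1 t i j) t ((picard n t *m B t) i j).
Proof.
move=> At /=.
have -> : (fun t => (\matrix_(i, j) \int[lebesgue_measure]_(s in `[0, t])
  (picard n s *m B s) i j) i j) =
  (fun t => \int[lebesgue_measure]_(s in `[0, t]) (picard n s *m B s) i j).
  by apply/funext => s; rewrite mxE.
by apply: Rintegral_has_deriv_within => //; apply: cont_on_mulmx => //;
  exact: picard_cont.
Qed.

Lemma cont_on_mx_bounded (Z : R -> 'M[R]_k) :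
  (forall i j, cont_on T (fun t => Z t i j)) ->
  exists2 C, 0 <= C & forall t, A t -> forall i j, `|Z t i j| <= C.
Proof.
move=> cZ; have /choice[c hc] : forall ij : 'I_k * 'I_k, exists C, 0 <= C /\
    forall t, A t -> `|Z t ij.1 ij.2| <= C.
  by move=> [i j]; have [C ? ?] := cont_on_bounded T0 (cZ i j); exists C.
have c0 ij : 0 <= c ij by have [] := hc ij.
exists (\sum_ij c ij) => [|t At i j]; first exact: sumr_ge0.
have [_ /(_ t At)/le_trans->//] := hc (i, j).
by rewrite (bigD1 (i, j))//= lerDl sumr_ge0.
Qed.

(** The largest entry is not a submultiplicative norm; the factor k that a product costs is absorbed
    into [C]. *)
Lemma mulmx_entry_bound : exists2 C, 0 <= C & forall t, A t ->
  forall (D : 'M[R]_k) a, 0 <= a -> (forall i j, `|D i j| <= a) ->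
  forall i j, `|(D *m B t) i j| <= a * C.
Proof.
have [C C0 BC] := cont_on_mx_bounded cB.
exists (\sum_(l < k) C) => [|t At D a a0 Da i j]; first exact: sumr_ge0.
rewrite mxE (le_trans (ler_norm_sum _ _ _))// mulr_sumr.
by apply: ler_sum => l _; rewrite normrM ler_pM//; exact: BC.
Qed.

(** The function K (C t)^(n+1) / (n+1)! has the assumed bound as its derivative, so the mean value
    inequality performs the integration. This is the inductive step of every factorial bound
    below. *)
Lemma exp_coeff_growth (f f' : R -> R) (K C : R) n :
  (forall t, A t -> dw f t (f' t)) -> f 0 = 0 ->
  (forall t, A t -> `|f' t| <= K * exp_coeff (C * t) n * C) ->
  forall t, A t -> `|f t| <= K * exp_coeff (C * t) n.+1.
Proof.
move=> df f0 hf' t At; have := At; rewrite /= in_itv/= => /andP[t0 tT].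
have := @le_norm_has_deriv_within R T f f'
  (fun t => K * C ^+ n.+1 / n.+1`!%:R * t ^+ n.+1)
  (fun t => K * C ^+ n.+1 / n.+1`!%:R * (n.+1%:R * t ^+ n)) 0 t df.
have -> : K * C ^+ n.+1 / n.+1`!%:R * t ^+ n.+1 - K * C ^+ n.+1 / n.+1`!%:R *
  0 ^+ n.+1 =
  K * exp_coeff (C * t) n.+1.
  by rewrite expr0n/= mulr0 subr0 /exp_coeff/= exprMn; ring.
rewrite f0 subr0; apply=> // s As.
  by apply: has_deriv_withinZ; exact: has_deriv_within_exp.
move=> _; apply: le_trans (hf' s As) _.
rewrite le_eqVlt; apply/orP; left; apply/eqP.
rewrite /exp_coeff/= factS natrM exprMn exprS.
have : n`!%:R != 0 :> R by rewrite pnatr_eq0 -lt0n fact_gt0.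
have : n.+1%:R != 0 :> R by rewrite pnatr_eq0.
by move: (n.+1%:R) (n`!%:R) => x y ? ?; field; apply/andP.
Qed.

Lemma picard_bound : exists2 C, 0 <= C &
  forall n t, A t -> forall i j, `|picard n t i j| <= exp_coeff (C * t) n.
Proof.
have [C C0 hC] := mulmx_entry_bound; exists C => //.
elim=> [|n IH] t At i j.
  rewrite /exp_coeff/= expr0 fact0 invr1 mulr1 mxE.
  by case: (i == j); rewrite ?normr1 ?normr0.
rewrite -[leRHS]mul1r; move: t At.
apply: (@exp_coeff_growth _ (fun t => (picard n t *m B t) i j)) => [t At||t At].
- exact: picardS_has_deriv_within.
- by rewrite picard0 mxE.
- rewrite mul1r; apply: hC => // [|i' j']; last exact: IH.
  apply: exp_coeff_ge0; rewrite mulr_ge0//.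
  by move: At; rewrite /= in_itv/= => /andP[].
Qed.

Lemma cvg_picard_series (Z : R -> 'M[R]_k) (mu : R) :
  (forall t, A t -> forall i j,
    dw (fun t => Z t i j) t (mu * (Z t *m B t) i j)) ->
  Z 0 = 1%:M -> forall t, A t -> forall i j,
  series (fun n => mu ^+ n * picard n t i j) @ \oo --> Z t i j.
Proof.
move=> dZ Z0; have [C C0 hC] := mulmx_entry_bound.
have cZ i j : cont_on T (fun t => Z t i j).
  by apply: deriv_cont_on => t At; exact: dZ.
have [K K0 ZK] := cont_on_mx_bounded cZ.
have step N t : A t -> forall i j,
    `|Z t i j - series (fun n => mu ^+ n * picard n t i j) N| <=
    K * exp_coeff (`|mu| * C * t) N.
  elim: N t => [|N IH] t At i j.
    (* The empty partial sum leaves [Z] itself, so [K] is the bound of its entries. *)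
    rewrite /series/= big_geq// subr0 /exp_coeff/= expr0 fact0 invr1 !mulr1.
    exact: ZK.
  move: t At; apply: (@exp_coeff_growth _ (fun t => mu *
      ((Z t - \matrix_(i, j) series (fun n => mu ^+ n * picard n t i j) N) *m
        B t) i j))
      => [t At||t At].
  (* The term n = 0 is constant and is split off; differentiating the others lowers their index, so
     the remainder after N + 1 terms has the one after N terms, times mu B, as its derivative. *)
  - have -> : (fun t => Z t i j - series
    (fun n => mu ^+ n * picard n t i j) N.+1) =
      (fun t => Z t i j + -1 * ((1%:M : 'M[R]_k) i j +
        \sum_(0 <= n < N) mu ^+ n.+1 * picard n.+1 t i j)).
      apply/funext => s; rewrite /series/= big_nat_recl// expr0 mul1r.
      by rewrite mulN1r.
    have MB (a b : 'M[R]_k) : (a - b) i j = a i j - b i j by rewrite !mxE.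
    rewrite mulmxBl MB mulrBr -[X in _ - X]mul1r -mulNr.
    apply: has_deriv_withinD; first exact: dZ.
    have -> : mu * ((\matrix_(i, j) series
      (fun n => mu ^+ n * picard n t i j) N)
       *m B t) i j = 0 + \sum_(0 <= n < N) mu ^+ n.+1 * (picard n t *m B t) i j.
      rewrite add0r mxE.
      rewrite mulr_sumr; under [RHS]eq_bigr do rewrite mxE mulr_sumr.
      rewrite exchange_big/=; apply: eq_bigr => l _; rewrite mxE /series/=.
      rewrite mulr_suml mulr_sumr; apply: eq_bigr => n _.
      by rewrite exprS; ring.
    apply: has_deriv_withinZ; apply: has_deriv_withinD.
      exact: has_deriv_within_cst.
    apply: has_deriv_within_sum => n; apply: has_deriv_withinZ.
    exact: picardS_has_deriv_within.
  - rewrite Z0 /series/= big_nat_recl// expr0 mul1r big1 ?addr0 ?subrr// => n _.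
    by rewrite picard0 mxE mulr0.
  - rewrite normrM; have := At; rewrite /= in_itv/= => /andP[t0 tT].
    have -> : K * exp_coeff (`|mu| * C * t) N * (`|mu| * C) =
      `|mu| * (K * exp_coeff (`|mu| * C * t) N * C) by ring.
    rewrite ler_wpM2l//; apply: hC => // [|i' j'].
      by rewrite mulr_ge0// exp_coeff_ge0// !mulr_ge0.
    by rewrite !mxE; exact: IH.
move=> t At i j.
have e0 : K * exp_coeff (`|mu| * C * t) N @[N --> \oo] --> (0 : R).
  rewrite -[X in _ --> X](mulr0 K); apply: cvgMl_tmp; exact: cvg_exp_coeff.
apply/cvgrPdist_le => e e_gt0.
have /cvgr0_norm_le/(_ _ e_gt0) := e0; apply: filterS => N.
by apply: le_trans; apply: le_trans (ler_norm _); exact: step.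
Qed.

(** A class of coefficients that contains Re z^n and Im z^n, is stable under the shift caused by
    differentiation in t, and is beaten by the factorial decay of P_n. *)
Definition geometric_growth (c : R^nat) :=
  exists K r, [/\ 0 <= K, 0 <= r & forall n, `|c n| <= K * r ^+ n].

Lemma geometric_growthS c : geometric_growth c ->
  geometric_growth (fun n => c n.+1).
Proof.
move=> [K [r [K0 r0 h]]]; exists (K * r), r; split=> //; first exact: mulr_ge0.
by move=> n; rewrite -mulrA -exprS.
Qed.

Definition picard_sum (c : R^nat) (t : R) : 'M[R]_k :=
  \matrix_(i, j) limn (series (fun n => c n * picard n t i j)).

(** Replacing t by T gives the majorant K (r C T)^n / n!, free of t; [e] is its tail. *)
Lemma picard_sum_uniform c : geometric_growth c ->
  exists2 e : R^nat, e @ \oo --> (0 : R) &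
  forall t, A t -> forall i j,
   cvgn (series (fun n => c n * picard n t i j)) /\
   forall N, `|picard_sum c t i j - series (fun n => c n * picard n t i j) N| <=
     e N.
Proof.
move=> [K [r [K0 r0 h]]]; have [C C0 hC] := picard_bound.
have V := @cvg_scaled_exp_series R K (r * (C * T)).
exists (fun N => K * expR (r * (C * T)) - series
  (fun n => K * exp_coeff (r * (C * T)) n) N).
  rewrite -[X in _ --> X](subrr (K * expR (r * (C * T)))).
  by apply: cvgB => //; exact: cvg_cst.
move=> t At i j; rewrite mxE; apply: dominated_series => // n.
have := At; rewrite /= in_itv/= => /andP[t0 tT].
rewrite normrM (_ : K * _ = K * r ^+ n * exp_coeff (C * T) n); last first.
  by rewrite /exp_coeff/= !exprMn; ring.
rewrite ler_pM//; apply: le_trans (hC n t At i j) _.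
rewrite /exp_coeff/= ler_wpM2r ?invr_ge0//.
by apply: lerXn2r; rewrite ?nnegrE ?mulr_ge0// ler_wpM2l.
Qed.

Lemma cvg_picard_sum c t i j : geometric_growth c -> A t ->
  series (fun n => c n * picard n t i j) @ \oo --> picard_sum c t i j.
Proof.
by move=> /picard_sum_uniform[e _ h] /h/(_ i j)[+ _]; rewrite mxE.
Qed.

(** Since the derivative of P_(n+1) is P_n B, termwise differentiation shifts the coefficients by
    one. *)
Lemma picard_sum_has_deriv_within c t i j : geometric_growth c -> A t ->
  dw (fun t => picard_sum c t i j) t
    ((picard_sum (fun n => c n.+1) t *m B t) i j).
Proof.
move=> gc At; have gc' := geometric_growthS gc.
have [e e0 he] := picard_sum_uniform gc'.
have [C C0 hC] := mulmx_entry_bound.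
pose P N t : 'M[R]_k := \matrix_(i, j) series
  (fun n => c n.+1 * picard n t i j) N.
have cP N i' j' : cont_on T (fun t => P N t i' j').
  have -> : (fun t => P N t i' j') =
    (fun t => \sum_(0 <= n < N) c n.+1 * picard n t i' j').
    by apply/funext => s; rewrite mxE.
  apply: cont_on_sum => n; apply: cont_onM; last exact: picard_cont.
  by move=> ? _; exact: cvg_cst.
(* Sums of N + 1 terms are paired with derivatives of N terms, since the constant term vanishes;
   multiplication by [B] enlarges the error to [e N * C]. *)
apply: (@uniform_limit_has_deriv_within R T _
    (fun t => (picard_sum (fun n => c n.+1) t *m B t) i j)
    (fun N t => series (fun n => c n * picard n t i j) N.+1)
    (fun N t => (P N t *m B t) i j) (fun N => e N * C)) => //.
- by rewrite -[X in _ --> X](mul0r C); apply: cvgMr_tmp.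
- move=> N s As.
  rewrite (_ : _ - _ = ((picard_sum (fun n => c n.+1) s - P N s) *m B s) i j);
    last first.
    by rewrite mulmxBl !mxE.
  apply: hC => // [|i' j'].
    by have [_ /(_ N)] := he s As i j; apply: le_trans.
  have [_ /(_ N)] := he s As i' j'; congr (_ <= _).
  by congr `|_|; rewrite !mxE.
- by move=> s As; rewrite -[X in X --> _]
    /([sequence (series (fun n => c n * picard n s i j)) N.+1]_N @ \oo) cvg_shiftS;
    exact: cvg_picard_sum.
- by move=> N; exact: cont_on_mulmx.
- move=> N s As.
  have -> : (fun t => series (fun n => c n * picard n t i j) N.+1) =
      (fun t => (c 0 * (1%:M : 'M[R]_k) i j +
        \sum_(0 <= n < N) c n.+1 * picard n.+1 t i j)).
    by apply/funext => u; rewrite /series/= big_nat_recl.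
  have -> : (P N s *m B s) i j =
      0 + \sum_(0 <= n < N) c n.+1 * (picard n s *m B s) i j.
    rewrite add0r !mxE; under [RHS]eq_bigr do rewrite mxE mulr_sumr.
    rewrite exchange_big/=; apply: eq_bigr => l _; rewrite mxE /series/=.
    by rewrite mulr_suml; apply: eq_bigr => n _; rewrite mulrA.
  apply: has_deriv_withinD; first exact: has_deriv_within_cst.
  apply: has_deriv_within_sum => n; apply: has_deriv_withinZ.
  exact: picardS_has_deriv_within.
Qed.

Lemma picard_sum0 c : picard_sum c 0 = (c 0)%:M.
Proof.
apply/matrixP => i j; rewrite !mxE; apply/cvg_lim => //.
rewrite -cvg_shiftS; apply: cvg_near_cst; near=> N.
rewrite /series/= big_nat_recl// big1 ?addr0 => [|n _].
  by rewrite mxE mulr_natr.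
by rewrite picard0 mxE mulr0.
Unshelve. all: by end_near. Qed.

End Picard.

(** * Simplex integrals, words and iterated integrals *)

Lemma tuple_rconsP (U : Type) (n : nat) (I : n.+1.-tuple U) :
  exists (J : n.-tuple U) (a : U), I = [tuple of rcons J a].
Proof.
case: I => s; case/lastP: s => [|s a] // sz.
have szs : size s == n by move: sz; rewrite size_rcons.
by exists (Tuple szs), a; apply: val_inj.
Qed.

Lemma tnth_rcons_widen (U : Type) (n : nat) (J : n.-tuple U) (a : U)
    (j : 'I_n) :
  tnth [tuple of rcons J a] (widen_ord (leqnSn n) j) = tnth J j.
Proof. by rewrite !(tnth_nth a) nth_rcons size_tuple/= ltn_ord. Qed.

Lemma tnth_rcons_max (U : Type) (n : nat) (J : n.-tuple U) (a : U) :
  tnth [tuple of rcons J a] ord_max = a.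
Proof. by rewrite (tnth_nth a)/= nth_rcons size_tuple ltnn eqxx. Qed.

Lemma mxprod_rcons (R : comPzRingType) (U : Type) (k : nat)
    (D : U -> 'M[R]_k) (s : seq U) (a : U) :
  \mxprod_(u <- rcons s a) D u = (\mxprod_(u <- s) D u) *m D a.
Proof.
elim: s => [|u s IH]; first by rewrite /= big_cons !big_nil mul1mx mulmx1.
by rewrite /= !big_cons IH mulmxA.
Qed.

Section IteratedIntegrals.
Variables (R : realType) (T : R).
Hypothesis T0 : 0 <= T.
Local Notation A := `[0, T]%classic.
Local Notation dw := (@has_deriv_within R R id R `[0, T]).

Lemma Rintegral_sumZ (I : finType) (c : I -> R) (f : I -> R -> R) t :
  (forall i, cont_on T (f i)) -> A t ->
  \int[lebesgue_measure]_(s in `[0, t]) (\sum_i c i * f i s) =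
  \sum_i c i * \int[lebesgue_measure]_(s in `[0, t]) f i s.
Proof.
move=> cf At.
apply: (@eq_has_deriv_within0 R T
  (fun t => \int[lebesgue_measure]_(s in `[0, t]) (\sum_i c i * f i s))
  (fun t => \sum_i c i * \int[lebesgue_measure]_(s in `[0, t]) f i s)
  (fun t => \sum_i c i * f i t)) => //.
- move=> s As; apply: Rintegral_has_deriv_within => //.
  by apply: cont_on_sum => i; apply: cont_onM => // u _; exact: cvg_cst.
- move=> s As; apply: has_deriv_within_sum => i; apply: has_deriv_withinZ.
  exact: Rintegral_has_deriv_within.
- rewrite set_itv1 Rintegral_set1 big1// => i _.
  by rewrite Rintegral_set1 mulr0.
Qed.

(** The weights [c] make the induction go through: peeling off the outermost factor [D s] replaces
    the column [c] by [D s] times [c], which is constant for the inner integrals. *)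
Lemma simplex_int_mxprod_row (k : nat) (D : R -> 'M[R]_k) (n : nat) (t : R)
    (r : 'I_k) (c : 'I_k -> R) :
  (forall i j, cont_on T (fun t => D t i j)) -> A t ->
  simplex_int t
    (fun s : n.-tuple R => \sum_i c i * (\mxprod_(u <- s) D u) r i) =
  \sum_i c i * picard D n t r i.
Proof.
move=> cD; elim: n t c => [|n IH] t c At /=.
  by apply: eq_bigr => i _; rewrite big_nil.
under [RHS]eq_bigr do rewrite mxE.
rewrite -Rintegral_sumZ//; last first.
  by move=> i; apply: cont_on_mulmx => // *; exact: picard_cont.
apply: eq_Rintegral => s; rewrite inE => As0.
have As : A s.
  move: As0 At; rewrite /= !in_itv/= => /andP[? ?] /andP[? ?].
  by apply/andP; split; lra.
transitivity (simplex_int s (fun u : n.-tuple R =>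
  \sum_l (\sum_i c i * D s l i) * (\mxprod_(v <- u) D v) r l)).
  congr simplex_int; apply/funext => u.
  under [RHS]eq_bigr do rewrite mulr_suml.
  rewrite exchange_big/=; apply: eq_bigr => i _.
  rewrite mxprod_rcons mxE mulr_sumr.
  by apply: eq_bigr => l _; ring.
rewrite IH//; under eq_bigr do rewrite mulr_suml.
rewrite exchange_big/=; apply: eq_bigr => i _.
by rewrite mxE mulr_sumr; apply: eq_bigr => l _; ring.
Qed.

Lemma simplex_int_mx_mxprod (k : nat) (D : R -> 'M[R]_k) (n : nat) (t : R) :
  (forall i j, cont_on T (fun t => D t i j)) -> A t ->
  simplex_int_mx t (fun s : n.-tuple R => \mxprod_(u <- s) D u) = picard D n t.
Proof.
move=> cD At; apply/matrixP => i j; rewrite mxE.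
have E (Z : 'M[R]_k) : Z i j = \sum_l (l == j)%:R * Z i l.
  by rewrite (bigD1 j)//= eqxx mul1r big1 ?addr0// => l /negbTE ->;
    rewrite mul0r.
rewrite E -simplex_int_mxprod_row//; congr simplex_int; apply/funext => s.
exact: E.
Qed.

Variables (d : nat) (x : 'I_d -> R -> R).
Hypothesis cx : forall a, cont_on T (x a).

(* Words are read from right to left: the head of [w] is the letter of the
   outermost integral. *)
Fixpoint word_int (w : seq 'I_d) (t : R) : R :=
  if w is a :: w' then
    \int[lebesgue_measure]_(s in `[0, t]) (word_int w' s * x a s)
  else 1.

Lemma word_int_cont w : cont_on T (word_int w).
Proof.
elim: w => [|a w IH]; first by move=> t _; exact: cvg_cst.
apply: deriv_cont_on => t At; apply: Rintegral_has_deriv_within => //.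
exact: cont_onM.
Qed.

(** The factor of the outermost variable is constant inside and joins [c]. The reversal appears
    because the outermost variable is last in the tuple but first in the word. *)
Lemma simplex_int_word (n : nat) (I : n.-tuple 'I_d) (c t : R) : A t ->
  simplex_int t (fun s : n.-tuple R =>
    c * \prod_(j < n) x (tnth I j) (tnth s j)) =
  c * word_int (rev I) t.
Proof.
elim: n I c t => [|n IH] I c t At /=.
  by rewrite big_ord0 (tuple0 I).
have [J [a ->]] := tuple_rconsP I.
rewrite rev_rcons/=.
have -> :
    c * \int[lebesgue_measure]_(s in `[0, t]) (word_int (rev J) s * x a s) =
    \int[lebesgue_measure]_(s in `[0, t]) (c * (word_int (rev J) s * x a s)).
  have := @Rintegral_sumZ 'I_1 (fun=> c)
    (fun=> fun s => word_int (rev J) s * x a s) t.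
  rewrite big_ord_recl big_ord0 addr0 => <-//.
    by apply: eq_Rintegral => s _; rewrite big_ord_recl big_ord0 addr0.
  by move=> _; apply: cont_onM => //; exact: word_int_cont.
apply: eq_Rintegral => s; rewrite inE => As0.
have As : A s.
  move: As0 At; rewrite /= !in_itv/= => /andP[? ?] /andP[? ?].
  by apply/andP; split; lra.
have -> : c * (word_int (rev J) s * x a s) =
  (c * x a s) * word_int (rev J) s by ring.
rewrite -IH//; congr (simplex_int _ _); apply/funext => u.
rewrite big_ord_recr/= tnth_rcons_max tnth_rcons_max.
under eq_bigr do rewrite !tnth_rcons_widen.
by ring.
Qed.

(** Noncommutative expansion of a product of sums into words. By induction both sides have the same
    derivative, and both vanish at 0 for positive length. *)
Lemma sum_word_int (k : nat) (N : 'I_d -> 'M[R]_k) (n : nat) (t : R) : A t ->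
  \sum_(I : n.-tuple 'I_d) word_int I t *: \mxprod_(a <- rev I) N a =
  picard (fun s => \sum_a x a s *: N a) n t.
Proof.
move=> At; apply/matrixP => i j.
elim: n t At i j => [|n IH] t At i j.
  rewrite (big_pred1 [tuple]) => [|I]; last by rewrite [I]tuple0.
  by rewrite /= big_nil scale1r.
pose f s := \sum_a \sum_(I : n.-tuple 'I_d)
   word_int (a :: I) s * (\mxprod_(b <- rev I) N b *m N a) i j.
have fE s : (\sum_(I : n.+1.-tuple 'I_d)
    word_int I s *: \mxprod_(a <- rev I) N a) i j = f s.
  rewrite summxE /f (reindex (fun p : 'I_d * n.-tuple 'I_d =>
    [tuple of p.1 :: p.2])) /=.
    rewrite pair_bigA; apply: eq_bigr => -[a I] _ /=.
    by rewrite mxE rev_cons mxprod_rcons.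
  exists (fun I : n.+1.-tuple 'I_d => (thead I, [tuple of behead I])).
    by move=> [a I] _ /=; congr (_, _); apply: val_inj.
  by move=> I _ /=; rewrite -tuple_eta.
rewrite fE.
have cB i' j' : cont_on T (fun s => (\sum_a x a s *: N a) i' j').
  have -> : (fun s => (\sum_a x a s *: N a) i' j') =
    (fun s => \sum_a x a s * N a i' j').
    by apply/funext => s; rewrite summxE; apply: eq_bigr => a _; rewrite mxE.
  by apply: cont_on_sum => a; apply: cont_onM => // u _; exact: cvg_cst.
apply: (@eq_has_deriv_within0 R T f
  (fun s => picard (fun s => \sum_a x a s *: N a) n.+1 s i j)
  (fun s => (picard (fun s => \sum_a x a s *: N a) n s *m (\sum_a x a s *: N a))
    i j) t T0 _ _ _ At).
- move=> s As.
  have -> : (picard (fun s => \sum_a x a s *: N a) n s *m (\sum_a x a s *: N a))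
    i j =
     \sum_a \sum_(I : n.-tuple 'I_d) (word_int I s * x a s) *
       (\mxprod_(b <- rev I) N b *m N a) i j.
    rewrite mulmx_sumr summxE; apply: eq_bigr => a _.
    rewrite -scalemxAr mxE.
    have -> : picard (fun s => \sum_a x a s *: N a) n s =
        \sum_(I : n.-tuple 'I_d) word_int I s *: \mxprod_(a <- rev I) N a.
      by apply/matrixP => i' j'; rewrite IH.
    rewrite mulmx_suml summxE mulr_sumr; apply: eq_bigr => I _.
    by rewrite -scalemxAl mxE; ring.
  apply: has_deriv_within_sum => a; apply: has_deriv_within_sum => I.
  set C := (_ *m _) i j.
  have -> : (fun s => word_int (a :: I) s * C) =
    (fun s => C * word_int (a :: I) s).
    by apply/funext => u; rewrite mulrC.
  rewrite mulrC; apply: has_deriv_withinZ.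
  apply: Rintegral_has_deriv_within => //; apply: cont_onM => //.
  exact: word_int_cont.
- by move=> s As; exact: picardS_has_deriv_within.
- rewrite picard0 mxE /f big1// => a _; rewrite big1// => I _.
  by rewrite /= set_itv1 Rintegral_set1 mul0r.
Qed.

End IteratedIntegrals.

(** * Termwise differentiation of power series over a general scalar field *)

Section PowerSeries.
Variables (K : numFieldType) (V : normedModType K).
Implicit Types (z h r : K) (c : nat -> V).

Definition deriv_coef c (n : nat) : V := n.+1%:R *: c n.+1.

(** The error of the first-order Taylor expansion of w^n at z; the case split avoids the exponent n
    - 1 at n = 0. *)
Definition pow_remainder z h (n : nat) : K :=
  (z + h) ^+ n - z ^+ n - (if n is m.+1 then m.+1%:R * h * z ^+ m else 0).

(* The remainders satisfy r_(n+1) = (z + h) r_n + n h^2 z^(n-1). *)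
Lemma pow_remainder_bound z h r n : `|h| <= 1 -> r = `|z| + 3 ->
  `|pow_remainder z h n| <= `|h| ^+ 2 * r ^+ n.
Proof.
move=> h1 rE; have r0 : 0 <= r by rewrite rE addr_ge0.
elim: n => [|n IH].
  by rewrite /pow_remainder !expr0 subrr subrr normr0 mulr1 exprn_ge0.
have -> : pow_remainder z h n.+1 = (z + h) * pow_remainder z h n +
    h ^+ 2 * (if n is m.+1 then m.+1%:R * z ^+ m else 0).
  rewrite /pow_remainder; case: n {IH} => [|m]; first by rewrite !expr0 !expr1;
    ring.
  by rewrite -[m.+2%:R]natr1 !exprS; ring.
have pow m : m.+1%:R * `|z| ^+ m <= (`|z| + 1) ^+ m.+1.
  elim: m => [|m IHm]; first by rewrite expr0 expr1 mulr1 lerDr.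
  rewrite -[m.+2%:R]natr1 mulrDl mul1r [leRHS]exprSr mulrDr mulr1 exprSr mulrA.
  apply: lerD; first by rewrite ler_wpM2r.
  by rewrite -exprSr lerXn2r ?nnegrE ?addr_ge0// lerDl.
apply: le_trans (ler_normD _ _) _.
(* Of the factor r, the part r - 1 = |z| + 2 absorbs |z + h|, and the remaining 1 absorbs the term n
   |z|^(n-1). *)
have -> : `|h| ^+ 2 * r ^+ n.+1 =
    (r - 1) * (`|h| ^+ 2 * r ^+ n) + `|h| ^+ 2 * r ^+ n
      by rewrite [r ^+ n.+1]exprS; ring.
apply: lerD.
  rewrite normrM ler_pM//; apply: le_trans (ler_normD _ _) _.
  rewrite rE -addrA lerD2l; apply: le_trans h1 _.
  by rewrite lerBrDr -(natrD _ 1 1) ler_nat.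
rewrite normrM normrX ler_wpM2l ?exprn_ge0//.
case: n {IH} => [|m]; first by rewrite normr0 expr0.
rewrite normrM normrX ger0_norm//; apply: le_trans (pow m) _.
by rewrite lerXn2r ?nnegrE ?addr_ge0// rE lerD2l ler1n.
Qed.

(** The Taylor remainders of the powers give an error of order |h|^2 for partial sums, uniformly in
    their length. Bounded partial sums of norms are all this asks for, so no completeness of [K] or
    [V] is involved. *)
Lemma is_derive_power_series c (f g : K -> V) (z0 z : K) :
  (forall r, 0 <= r ->
    exists C, forall N, \sum_(0 <= n < N) `|c n| * r ^+ n <= C) ->
  (forall w, series (fun n => (w - z0) ^+ n *: c n) @ \oo --> f w) ->
  series (fun n => (z - z0) ^+ n *: deriv_coef c n) @ \oo --> g z ->
  is_derive z 1 f (g z).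
Proof.
move=> bc cf cg.
pose r := `|z - z0| + 3; have r0 : 0 <= r by rewrite addr_ge0.
have [C hC] := bc r r0.
have C0 : 0 <= C by have := hC 0; rewrite big_geq.
have C3 : 0 < C + 3 by rewrite ltr_wpDl.
pose p w N := series (fun n => (w - z0) ^+ n *: c n) N.+1.
pose q N := series (fun n => (z - z0) ^+ n *: deriv_coef c n) N.
have pq h N : `|h| <= 1 -> `|p (h + z) N - p z N - h *: q N| <= C * `|h| ^+ 2.
  move=> h1; have -> : p (h + z) N - p z N - h *: q N =
      \sum_(0 <= n < N.+1) pow_remainder (z - z0) h n *: c n.
    have -> : h *: q N = \sum_(0 <= n < N.+1)
        (if n is m.+1 then m.+1%:R * h * (z - z0) ^+ m else 0) *: c n.
      rewrite big_nat_recl// scale0r add0r /q /series/= scaler_sumr.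
      apply: eq_bigr => n _; rewrite /deriv_coef !scalerA; congr (_ *: _); ring.
    rewrite /p /series/= -!sumrB; apply: eq_bigr => n _.
    by rewrite /pow_remainder -!scalerBl; congr ((_ ^+ _ - _ - _) *: _); ring.
  apply: le_trans (ler_norm_sum _ _ _) _.
  apply: (@le_trans _ _ (\sum_(0 <= n < N.+1) `|h| ^+ 2 * (`|c n| * r ^+ n))).
    apply: ler_sum => n _; rewrite normrZ mulrCA mulrC ler_wpM2l//.
    exact: pow_remainder_bound.
  by rewrite -mulr_sumr mulrC ler_wpM2r ?exprn_ge0.
(* [C] comes from the partial sums; 3 pays for replacing f(z + h), f(z) and h g(z) by them, each at
   cost |h|^2. The length N may depend on h. *)
have main h : h != 0 -> `|h| <= 1 -> `|f (h + z) - f z - h *: g z| <=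
  (C + 3) * `|h| ^+ 2.
  move=> h0 h1; have hp : 0 < `|h| by rewrite normr_gt0.
  have h2 : 0 < `|h| ^+ 2 by rewrite exprn_gt0.
  have cf' w : p w @ \oo --> f w.
    by rewrite -[X in X --> _]/([sequence
      (series (fun n => (w - z0) ^+ n *: c n)) N.+1]_N @ \oo) cvg_shiftS.
  near \oo => N.
  have f1 : `|f (h + z) - p (h + z) N| <= `|h| ^+ 2.
    by near: N; move/cvgrPdist_le : (cf' (h + z)); exact.
  have f2 : `|f z - p z N| <= `|h| ^+ 2.
    by near: N; move/cvgrPdist_le : (cf' z); exact.
  have g1 : `|g z - q N| <= `|h|.
    by near: N; move/cvgrPdist_le : cg; exact.
  have -> : f (h + z) - f z - h *: g z = (f (h + z) - p (h + z) N) +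
      (- (f z - p z N)) + (- (h *: (g z - q N))) +
        (p (h + z) N - p z N - h *: q N).
    rewrite scalerBr; move: (f _) (f _) (h *: g z) (h *: q N) (p _ _) (p _ _) =>
      a b c1 d e e'.
    rewrite !opprB [RHS](AC (2*2*2*3) (1*4*6*(2*7)*(3*8)*(5*9)))/=.
    by rewrite addNr !subrr !addr0.
  rewrite mulrDl; apply: le_trans (ler_normD _ _) _; rewrite addrC; apply: lerD.
    exact: pq.
  apply: le_trans (ler_normD _ _) _; rewrite normrN normrZ.
  have -> : 3 * `|h| ^+ 2 = `|h| ^+ 2 + `|h| ^+ 2 + `|h| * `|h| by ring.
  apply: lerD; last by rewrite ler_wpM2l.
  by apply: le_trans (ler_normD _ _) _; rewrite normrN; exact: lerD.
suff H : (fun h => h^-1 *: ((f \o shift z) (h *: 1) - f z)) @ 0^' --> g z.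
  split; first by apply/cvg_ex; exists (g z).
  exact/cvg_lim.
apply/cvgrPdist_le => e e0; rewrite /dnbhs near_withinE; near=> h => h0.
have hp : 0 < `|h| by rewrite normr_gt0.
have h1 : `|h| <= 1 by near: h; apply: (@nbhs0_le _ K^o).
have he : `|h| <= e / (C + 3) by near: h; apply: (@nbhs0_le _ K^o);
  rewrite divr_gt0.
rewrite /= -(ler_pM2l hp) -normrZ scalerBr scalerA divff// scale1r distrC.
rewrite [h *: 1]mulr1; apply: le_trans (main h h0 h1) _.
by rewrite mulrC expr2 -mulrA ler_wpM2l// -ler_pdivlMr.
Unshelve. all: by end_near. Qed.

End PowerSeries.

(** * Real power series of infinite radius and their higher derivatives *)

Section EntireSeries.
Variables (R : realType).

(** Decay like B^n / n! survives both formal differentiation and multiplication by x^n, so all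
    derived series converge everywhere. *)
Definition exp_growth (V : normedModType R) (c : nat -> V) :=
  exists A B : R, [/\ 0 <= A, 0 <= B & forall n, `|c n| <= A * exp_coeff B n].

Lemma exp_growth_bound (c : R^nat) (A B r : R) : 0 <= r ->
  (forall n, c n <= A * exp_coeff B n) ->
  forall N, \sum_(0 <= n < N) c n * r ^+ n <=
    \sum_(0 <= n < N) A * exp_coeff (B * r) n.
Proof.
move=> r0 h N; apply: ler_sum => n _.
rewrite (_ : A * _ = A * exp_coeff B n * r ^+ n);
  last by rewrite /exp_coeff/= exprMn; ring.
by rewrite ler_wpM2r ?exprn_ge0.
Qed.

Lemma exp_growth_deriv_coef (V : normedModType R) (c : nat -> V) :
  exp_growth c -> exp_growth (deriv_coef c).
Proof.
move=> [A [B [A0 B0 h]]]; exists (A * B), B; split=> //; first exact: mulr_ge0.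
move=> n; rewrite /deriv_coef normrZ ger0_norm//.
apply: (@le_trans _ _ (n.+1%:R * (A * exp_coeff B n.+1))).
  by rewrite ler_wpM2l//; exact: h.
rewrite /exp_coeff/= factS natrM exprS.
have : n`!%:R != 0 :> R by rewrite pnatr_eq0 -lt0n fact_gt0.
have : n.+1%:R != 0 :> R by rewrite pnatr_eq0.
move: (n.+1%:R) (n`!%:R) => x y x0 y0.
by rewrite le_eqVlt; apply/orP; left; apply/eqP; field; apply/andP.
Qed.

Lemma sum_exp_coeff_le (A B : R) N : 0 <= A -> 0 <= B ->
  \sum_(0 <= n < N) A * exp_coeff B n <= A * expR B.
Proof.
move=> A0 B0; rewrite -mulr_sumr ler_wpM2l//.
have := @nondecreasing_cvgn_le R (series (exp_coeff B)) _
  (is_cvg_series_exp_coeff B) N.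
apply; apply/nondecreasing_seqP => n.
by rewrite /series/= big_nat_recr//= lerDl exp_coeff_ge0.
Qed.

(* The first hypothesis stands for the completeness of [V]: there is no
   completeNormedModType instance on matrices of arbitrary size. *)
Lemma derive1n_entire (V : normedModType R) (c : nat -> V)
    (f : R -> V) (x0 : R) :
  (forall u : nat -> V, exp_growth u -> cvgn (series u)) ->
  exp_growth c ->
  (forall x, series (fun n => (x - x0) ^+ n *: c n) @ \oo --> f x) ->
  forall m, derivable (derive1n m f) x0 1 /\ derive1n m f x0 = m`!%:R *: c m.
Proof.
move=> cplt gc cf.
have growthX (u : nat -> V) y : exp_growth u ->
  exp_growth (fun n => y ^+ n *: u n).
  move=> [A [B [A0 B0 h]]]; exists A, (`|y| * B); split=> //;
    first exact: mulr_ge0.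
  move=> n; rewrite normrZ normrX (_ : A * _ = `|y| ^+ n * (A * exp_coeff B n)).
    by rewrite ler_wpM2l ?exprn_ge0//; exact: h.
  by rewrite /exp_coeff/= exprMn; ring.
have bound (u : nat -> V) : exp_growth u -> forall r, 0 <= r ->
    exists C, forall N, \sum_(0 <= n < N) `|u n| * r ^+ n <= C.
  move=> [A [B [A0 B0 h]]] r r_ge0; exists (A * expR (B * r)) => N.
  apply: le_trans (exp_growth_bound r_ge0 h N) _.
  by apply: sum_exp_coeff_le => //; exact: mulr_ge0.
pose cm m := iter m (@deriv_coef R V) c.
have gm m : exp_growth (cm m) by elim: m => // m; exact: exp_growth_deriv_coef.
(* The m-th formal derivative carries the falling factorial (n + m)! / n!, which is m! at n = 0, the
   only term left at [x0]. *)
have cmE m n : cm m n = ((n + m) ^_ m)%N%:R *: c (n + m)%N.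
  elim: m n => [|m IH] n; first by rewrite ffactn0 scale1r addn0.
  rewrite /cm iterS /deriv_coef -/(cm m) IH scalerA -natrM addSnnS ffactnSr.
  by rewrite addnS subSn ?leq_addl// addnK mulnC.
have D m :
    (forall x : R, series (fun n => (x - x0) ^+ n *: cm m n) @ \oo -->
      derive1n m f x) ->
    forall x : R, is_derive x (1 : R) (derive1n m f)
      (limn (series (fun n => (x - x0) ^+ n *: cm m.+1 n))).
  move=> h x.
  apply: (@is_derive_power_series _ _ (cm m) _
    (fun x => limn (series (fun n => (x - x0) ^+ n *: cm m.+1 n))) x0) => //.
    exact: bound.
  by apply: cplt; exact: growthX (gm m.+1).
have S m x : series (fun n => (x - x0) ^+ n *: cm m n) @ \oo --> derive1n m f x.
  elim: m x => [|m IH] x; first exact: cf.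
  have [_ E] := D m IH x; rewrite derive1nS derive1E E.
  by apply: cplt; exact: growthX (gm m.+1).
move=> m; split; first by have [] := D m (S m) x0.
rewrite -[LHS](cvg_lim _ (S m x0))//; apply/cvg_lim => //.
rewrite -cvg_shiftS; apply: cvg_near_cst; near=> N.
rewrite /series/= big_nat_recl// big1 ?addr0 => [|n _].
  by rewrite subrr expr0 scale1r cmE add0n ffactnn.
by rewrite subrr expr0n scale0r.
Unshelve. all: by end_near. Qed.

End EntireSeries.

(** * Scaling of tensor maps and series of complex numbers *)

Lemma map_mxprod (R R' : comPzRingType) (f : {rmorphism R -> R'}) (U : Type)
  (k : nat)
    (D : U -> 'M[R]_k) (s : seq U) :
  map_mx f (\mxprod_(u <- s) D u) = \mxprod_(u <- s) map_mx f (D u).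
Proof.
elim: s => [|u s IH]; first by rewrite !big_nil map_mx1.
by rewrite !big_cons map_mxM IH.
Qed.

Lemma mxprodZ (R : comPzRingType) (U : Type) (k : nat) (a : R)
    (D : U -> 'M[R]_k) (s : seq U) :
  \mxprod_(u <- s) (a *: D u) = a ^+ size s *: \mxprod_(u <- s) D u.
Proof.
elim: s => [|u s IH]; first by rewrite !big_nil scale1r.
by rewrite !big_cons IH -scalemxAl -scalemxAr scalerA -exprS.
Qed.

Lemma tensor_mapZ (R : realType) (d k : nat)
    (M : 'rV[R]_d -> 'M[R[i]]_k) (z : R[i])
    (n : nat) (x : tensor R d n) :
  tensor_map (z \*: M) x = z ^+ n *: tensor_map M x.
Proof.
rewrite /tensor_map scaler_sumr; apply: eq_bigr => I _.
by rewrite mxprodZ size_tuple !scalerA mulrC.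
Qed.

Lemma eq_cvg_series (K : numFieldType) (V : normedModType K)
    (u v : nat -> V) (l : V) :
  u =1 v -> series u @ \oo --> l -> series v @ \oo --> l.
Proof. by move=> /funext ->. Qed.

Lemma series_complex (R : realType) (u v : R^nat) (a b : R) :
  series u @ \oo --> a -> series v @ \oo --> b ->
  series (fun n => u n +i* v n) @ \oo --> (a +i* b : R[i]).
Proof.
move=> ua vb.
have -> : series (fun n => u n +i* v n) = (fun N => series u N +i* series v N).
  apply/funext; elim=> [|N IH]; first by rewrite /series/= !big_geq.
  by rewrite !seriesSr IH.
exact: cvg_complex.
Qed.

Lemma normc_ge_Im (R : rcfType) (z : R[i]) : `|complex.Im z|%:C <= `|z|.
Proof.
by rewrite normc_def lecR -[leLHS]sqrtr_sqr ler_wsqrtr// lerDr sqr_ge0.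
Qed.

Lemma dominated_series_complex (R : realType) (u : nat -> R[i]) (v : R^nat) :
  (forall n, `|u n| <= (v n)%:C) -> cvgn (series v) ->
  exists l : R[i], series u @ \oo --> l.
Proof.
move=> uv /cvg_ex[V vV].
have hRe n : `|complex.Re (u n)| <= v n.
  by rewrite -lecR; apply: le_trans (uv n); exact: normc_ge_Re.
have hIm n : `|complex.Im (u n)| <= v n.
  rewrite -lecR; apply: le_trans (uv n).
  exact: normc_ge_Im.
have [cRe _] := dominated_series hRe vV;
  have [cIm _] := dominated_series hIm vV.
have := series_complex cRe cIm.
have -> : (fun n => complex.Re (u n) +i* complex.Im (u n)) = u.
  by apply/funext => n; case: (u n).
by exists (limn (series (fun n => complex.Re (u n))) +i* limn
  (series (fun n => complex.Im (u n)))).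
Qed.

Lemma cvg_mulmxr (K : numFieldType) (U : Type) (F : set_system U) (m n p : nat)
    (f : U -> 'M[K]_(m, n)) (l : 'M[K]_(m, n)) (N : 'M[K]_(n, p)) : Filter F ->
  f x @[x --> F] --> l -> f x *m N @[x --> F] --> l *m N.
Proof.
move=> FF /cvg_mxP fl; apply/cvg_mxP => i j.
have -> : (fun x => (f x *m N) i j) = (fun x => \sum_l f x i l * N l j).
  by apply/funext => x; rewrite mxE.
rewrite mxE; elim: (index_enum _) => [|a r IH].
  rewrite big_nil; have -> : (fun x => \sum_(l <- [::]) f x i l * N l j) =
    cst 0.
    by apply/funext => x; rewrite big_nil.
  exact: cvg_cst.
rewrite big_cons; have -> : (fun x => \sum_(l <- a :: r) f x i l * N l j) =
    (fun x => f x i a * N a j + \sum_(l <- r) f x i l * N l j).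
  by apply/funext => x; rewrite big_cons.
by apply: cvgD => //; apply: cvgMr_tmp.
Qed.

(** * Derivatives and norms of real matrices *)

Section RealMatrices.
Variables (R : realType) (T : R).
Local Notation A := `[0, T]%classic.
Local Notation dw := (@has_deriv_within R R id R `[0, T]).

Lemma has_deriv_within_mxP (m n : nat)
    (f : R -> 'M[R]_(m, n)) t (l : 'M[R]_(m, n)) :
  has_deriv_within id A f t l <-> forall i j, dw (fun s => f s i j) t (l i j).
Proof.
rewrite /has_deriv_within; split=> [/cvg_mxP fl i j|fl].
  apply: cvg_trans (fl i j); apply: near_eq_cvg; near=> s.
  by rewrite !mxE.
apply/cvg_mxP => i j; apply: cvg_trans (fl i j); apply: near_eq_cvg; near=> s.
by rewrite !mxE.
Unshelve. all: by end_near. Qed.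

Lemma has_deriv_within_mulmx (m n p : nat) (f : R -> 'M[R]_(m, n))
    (g : R -> 'M[R]_(n, p))
    t (f' : 'M[R]_(m, n)) (g' : 'M[R]_(n, p)) :
  has_deriv_within id A f t f' -> has_deriv_within id A g t g' ->
  has_deriv_within id A (fun s => f s *m g s) t (f' *m g t + f t *m g').
Proof.
move=> /has_deriv_within_mxP df /has_deriv_within_mxP dg;
  apply/has_deriv_within_mxP => i j.
have -> : (fun s => (f s *m g s) i j) = (fun s => \sum_l f s i l * g s l j).
  by apply/funext => s; rewrite mxE.
rewrite !mxE -big_split; apply: has_deriv_within_sum => l.
exact: has_deriv_withinM.
Qed.

Lemma has_deriv_within_tr (m n : nat)
    (f : R -> 'M[R]_(m, n)) t (f' : 'M[R]_(m, n)) :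
  has_deriv_within id A f t f' ->
    has_deriv_within id A (fun s => (f s)^T) t f'^T.
Proof.
move=> /has_deriv_within_mxP df; apply/has_deriv_within_mxP => i j.
have -> : (fun s => (f s)^T i j) = (fun s => f s j i).
  by apply/funext => s; rewrite mxE.
by rewrite mxE.
Qed.

Lemma eq_has_deriv_within_mx0 (m n : nat)
    (f : R -> 'M[R]_(m, n)) (c : 'M[R]_(m, n)) t : 0 <= T ->
  (forall t, A t -> has_deriv_within id A f t 0) -> f 0 = c -> A t -> f t = c.
Proof.
move=> T0 df f0 At; apply/matrixP => i j.
apply: (@eq_has_deriv_within0 R T (fun t => f t i j) (fun=> c i j) (fun=> 0))
  => //.
- by move=> s As; have /has_deriv_within_mxP/(_ i j) := df s As; rewrite mxE.
- by move=> s As; exact: has_deriv_within_cst.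
- by rewrite f0.
Qed.

Lemma mx_norm_entry (m n : nat) (D : 'M[R]_(m, n)) i j : `|D i j| <= `|D|.
Proof.
rewrite [leRHS]/Num.norm /= mx_normrE.
by apply/bigmax_geP; right => /=; exists (i, j).
Qed.

Lemma mx_norm_le (m n : nat) (D : 'M[R]_(m, n)) a : 0 <= a ->
  (forall i j, `|D i j| <= a) -> `|D| <= a.
Proof.
move=> a0 h; rewrite [leLHS]/Num.norm /= mx_normrE.
by apply: bigmax_le => // -[i j] _; exact: h.
Qed.

(** Convergence entry by entry; this discharges the completeness hypothesis of [derive1n_entire] for
    matrices. *)
Lemma exp_growth_mx_cvg (m n : nat) (u : nat -> 'M[R]_(m, n)) : exp_growth u ->
  cvgn (series u).
Proof.
move=> [a [b [a0 b0 h]]].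
have hij i j N : `|u N i j| <= a * exp_coeff b N.
  by apply: le_trans (h N); exact: mx_norm_entry.
apply/cvg_ex; exists (\matrix_(i, j) limn (series (fun N => u N i j))).
apply/cvg_mxP => i j; rewrite mxE.
have [c _] := dominated_series (hij i j) (@cvg_scaled_exp_series R a b).
suff -> : (fun N => series u N i j) = series (fun N => u N i j) by [].
by apply/funext => N; rewrite /series/= summxE.
Qed.

End RealMatrices.

(** * The real equation driven by the path *)

Section Path.
Variables (R : realType) (d k : nat) (T : R) (X : R -> 'rV[R]_d).
Variable M : {linear 'rV[R]_d -> 'M[R]_k}.
Hypothesis T0 : 0 <= T.
Hypothesis X_smooth : smooth_on `[0, T] X.
Local Notation A := `[0, T]%classic.
Local Notation X' := (deriv_within A X).
Local Notation B := (fun s : R => M (X' s)).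

(** Smoothness at order one makes X' differentiable within [0, T], hence continuous. *)
Lemma smooth_deriv_cont a : cont_on T (fun s => X' s 0 a).
Proof.
move=> t At; have [l /has_deriv_within_mxP/(_ 0 a)] := X_smooth 1 At.
exact: has_deriv_within_cont.
Qed.

Lemma driver_decomp s : M (X' s) = \sum_a X' s 0 a *: M (delta_mx 0 a).
Proof.
rewrite [in LHS](row_sum_delta (X' s)) linear_sum.
by apply: eq_bigr => a _; rewrite linearZ.
Qed.

Lemma driver_cont i j : cont_on T (fun s => M (X' s) i j).
Proof.
have -> : (fun s => M (X' s) i j) =
  (fun s => \sum_a X' s 0 a * M (delta_mx 0 a) i j).
  by apply/funext => s; rewrite driver_decomp summxE; apply: eq_bigr => a _;
    rewrite mxE.
apply: cont_on_sum => a; apply: cont_onM; first exact: smooth_deriv_cont.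
by move=> t _; exact: cvg_cst.
Qed.

(** Signature coordinates are word integrals of the components of X', and [M X'] is the combination
    of the matrices [M e_a] with these components, so summing over words gives P_n. *)
Lemma tensor_map_signature n t : A t ->
  tensor_map (fun x => cplx_mx (M x)) (signature T X t n) =
    cplx_mx (picard B n t).
Proof.
move=> At; have -> : B = (fun s => \sum_a X' s 0 a *: M (delta_mx 0 a)).
  by apply/funext => s; exact: driver_decomp.
rewrite -(@sum_word_int _ _ T0 _ _ smooth_deriv_cont)// /tensor_map /cplx_mx
  raddf_sum/=.
have revtK : involutive (fun I : n.-tuple 'I_d => [tuple of rev I]).
  by move=> I; apply: val_inj; exact: revK.
rewrite [RHS](reindex_inj (inv_inj revtK))/=.
apply: eq_bigr => I _; rewrite map_mxZ revK map_mxprod ffunE; congr (_%:C *: _).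
rewrite -[RHS]mul1r -(simplex_int_word T0 smooth_deriv_cont)//.
congr (simplex_int _ _); apply/funext => s.
rewrite mul1r ffunE; apply: eq_bigr => j _.
by rewrite tnth_map.
Qed.

Variable Y : R -> R -> 'M[R]_k.
Hypothesis M_so : forall x, so_mx (M x).
Hypothesis Y_init : forall lam, Y lam 0 = 1%:M.
Hypothesis Y_ode : forall lam t, A t ->
  has_deriv_within id A (Y lam) t (Y lam t *m (lam *: M (X' t))).

Lemma solution_mulmx_tr_has_deriv_within mu lam t : A t ->
  has_deriv_within id A (fun s => Y mu s *m (Y lam s)^T) t
    ((mu - lam) *: (Y mu t *m M (X' t) *m (Y lam t)^T)).
Proof.
move=> At.
have := has_deriv_within_mulmx (@Y_ode mu t At)
  (has_deriv_within_tr (@Y_ode lam t At)).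
congr (has_deriv_within _ _ _ _ _).
have E : (lam *: M (X' t))^T = - (lam *: M (X' t)).
  by rewrite linearZ/= M_so scalerN.
rewrite trmx_mul E mulNmx mulmxN mulmxA -!scalemxAr -!scalemxAl.
by rewrite -scalerBl.
Qed.

Lemma solution_mulmx_tr lam t : A t -> Y lam t *m (Y lam t)^T = 1%:M.
Proof.
move: t; move=> t At.
apply: (@eq_has_deriv_within_mx0 R T _ _ (fun t => Y lam t *m (Y lam t)^T))
  => //.
  move=> s As; have := @solution_mulmx_tr_has_deriv_within lam lam s As.
  by rewrite subrr scale0r.
by rewrite Y_init trmx1 mulmx1.
Qed.

Lemma solution_tr_mulmx lam t : A t -> (Y lam t)^T *m Y lam t = 1%:M.
Proof. by move=> At; apply: mulmx1C; exact: solution_mulmx_tr. Qed.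

(** Orthogonality trades the inverse for a transpose, whose entries are visibly continuous. *)
Lemma Ad_solution lam t N : A t -> Ad (Y lam t) N = Y lam t *m N *m (Y lam t)^T.
Proof.
move=> At; rewrite /Ad; congr (_ *m _).
have [U _] := mulmx1_unit (solution_mulmx_tr lam At).
by rewrite -[RHS](mulKmx U) solution_mulmx_tr// mulmx1.
Qed.

Local Notation D lam := (fun u : R => Ad (Y lam u) (M (X' u))).

Lemma solution_cont lam i j : cont_on T (fun t => Y lam t i j).
Proof.
apply: deriv_cont_on => t At; have /has_deriv_within_mxP := @Y_ode lam t At;
  exact.
Qed.

Lemma Ad_solution_cont lam i j : cont_on T (fun t => D lam t i j).
Proof.
apply: (@eq_cont_on _ _ (fun t => (Y lam t *m M (X' t) *m (Y lam t)^T) i j)).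
  by move=> t /set_mem At; rewrite Ad_solution.
apply: cont_on_mulmx => i' j'.
  by apply: cont_on_mulmx => *; [exact: solution_cont|exact: driver_cont].
have -> : (fun t => (Y lam t)^T i' j') = (fun t => Y lam t j' i').
  by apply/funext => t; rewrite mxE.
exact: solution_cont.
Qed.

(* [Y mu *m (Y lam)^T] solves the equation driven by [(mu - lam) *: D lam],
   so its expansion in iterated integrals is the Taylor expansion at [lam]. *)
Lemma cvg_solution_taylor mu lam t : A t ->
  series (fun n => (mu - lam) ^+ n *: (picard (D lam) n t *m Y lam t)) @ \oo
    --> Y mu t.
Proof.
move=> At.
have H i j : series (fun n => (mu - lam) ^+ n * picard (D lam) n t i j)
  @ \oo -->
    (Y mu t *m (Y lam t)^T) i j.
  apply: (cvg_picard_series T0 (@Ad_solution_cont lam) (Z :=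
    fun t => Y mu t *m (Y lam t)^T)) => //.
    move=> s As i' j'.
    have /has_deriv_within_mxP/(_ i' j') :=
      @solution_mulmx_tr_has_deriv_within mu lam s As.
    (* Inserting [(Y lam)^T *m Y lam = 1] turns [Y mu *m M X' *m (Y lam)^T] into the product of
       [Y mu *m (Y lam)^T] and the conjugated driver. *)
    rewrite mxE Ad_solution// !mulmxA -(mulmxA (Y mu s) (Y lam s)^T)
      solution_tr_mulmx// mulmx1.
    exact.
  by rewrite !Y_init trmx1 mulmx1.
have -> : Y mu t = (Y mu t *m (Y lam t)^T) *m Y lam t.
  by rewrite -mulmxA solution_tr_mulmx// mulmx1.
have -> : series (fun n => (mu - lam) ^+ n *: (picard (D lam) n t *m Y lam t)) =
    (fun N => series (fun n => (mu - lam) ^+ n *: picard (D lam) n t) N *m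
      Y lam t).
  apply/funext => N; rewrite /series/= mulmx_suml.
  by apply: eq_bigr => n _; rewrite scalemxAl.
apply: cvg_mulmxr; apply/cvg_mxP => i j.
suff -> : (fun N => series (fun n => (mu - lam) ^+ n *: picard (D lam) n t) N i
  j) =
    series (fun n => (mu - lam) ^+ n * picard (D lam) n t i j) by exact: H.
apply/funext => N; rewrite /series/= summxE.
by apply: eq_bigr => n _; rewrite mxE.
Qed.

Lemma solution_derive1n lam t n : A t ->
  derivable (derive1n n (fun l => Y l t)) lam 1 /\
  derive1n n (fun l => Y l t) lam = n`!%:R *: (picard (D lam) n t *m Y lam t).
Proof.
move=> At; move: n.
apply: (@derive1n_entire R _ (fun n => picard (D lam) n t *m Y lam t)).
- exact: exp_growth_mx_cvg.
- have [C C0 hC] := picard_bound T0 (@Ad_solution_cont lam).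
  (* The product bound is applied with [Y lam] as right factor, so the coefficients keep the
     factorial decay of the iterated integrals. *)
  have [C' C'0 hC'] := mulmx_entry_bound T0 (@solution_cont lam).
  have Ct0 : 0 <= C * t by rewrite mulr_ge0//; move: At;
    rewrite /= in_itv => /andP[].
  exists C', (C * t); split=> // n; apply: mx_norm_le.
    by rewrite mulr_ge0// exp_coeff_ge0.
  move=> i j; rewrite mulrC; apply: hC' => //; first exact: exp_coeff_ge0.
  by move=> *; exact: hC.
- by move=> mu; exact: cvg_solution_taylor.
Qed.

Lemma solution_real_analytic t i j : A t ->
  real_analytic (fun lam => Y lam t i j).
Proof.
(* The expansion converges everywhere, so the radius is arbitrary. *)
move=> At lam; exists 1; split=> //.
exists (fun n => (picard (D lam) n t *m Y lam t) i j) => mu _.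
have /cvg_mxP/(_ i j) := @cvg_solution_taylor mu lam t At.
apply: cvg_trans; apply: near_eq_cvg; near=> N; rewrite /series/= summxE.
by apply: eq_bigr => n _; rewrite mxE mulrC.
Unshelve. all: by end_near.
Qed.

Lemma cvg_solution lam t i j : A t ->
  series (fun n => lam ^+ n * picard B n t i j) @ \oo --> Y lam t i j.
Proof.
move=> At; apply: (cvg_picard_series T0 driver_cont) => // s As i' j'.
have /has_deriv_within_mxP/(_ i' j') := @Y_ode lam s As.
by rewrite -scalemxAr mxE.
Qed.

End Path.

(** * The entire extension in z and its equation in t *)

Section ComplexExtension.
Variables (R : realType) (k : nat) (T : R) (B : R -> 'M[R]_k).
Hypothesis T0 : 0 <= T.
Hypothesis cB : forall i j, cont_on T (fun t => B t i j).
Local Notation A := `[0, T]%classic.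

Lemma geometric_growth_Re (z : R[i]) :
  geometric_growth (fun n => complex.Re (z ^+ n)).
Proof.
exists 1, (complex.Re `|z|).
have E : `|z| = (complex.Re `|z|)%:C by rewrite normc_def.
split=> //; first by rewrite -lecR -E; exact: normr_ge0.
by move=> n; rewrite mul1r -lecR rmorphXn/= -E -normrX; exact: normc_ge_Re.
Qed.

Lemma geometric_growth_Im (z : R[i]) :
  geometric_growth (fun n => complex.Im (z ^+ n)).
Proof.
exists 1, (complex.Re `|z|).
have E : `|z| = (complex.Re `|z|)%:C by rewrite normc_def.
split=> //; first by rewrite -lecR -E; exact: normr_ge0.
move=> n; rewrite mul1r -lecR rmorphXn/= -E -normrX.
exact: normc_ge_Im.
Qed.

(** The sum of z^n P_n, split into real and imaginary parts so that the real results on [picard_sum]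
    apply to each. *)
Definition complex_solution (z : R[i]) (t : R) : 'M[R[i]]_k :=
  \matrix_(i, j) (picard_sum B (fun n => complex.Re (z ^+ n)) t i j +i*
                  picard_sum B (fun n => complex.Im (z ^+ n)) t i j).

Lemma cvg_complex_solution_entry z t i j : A t ->
  series (fun n => z ^+ n * (picard B n t i j)%:C) @ \oo
    --> complex_solution z t i j.
Proof.
move=> At; rewrite mxE.
have := series_complex
  (cvg_picard_sum T0 cB (i := i) (j := j) (geometric_growth_Re z) At)
  (cvg_picard_sum T0 cB (i := i) (j := j) (geometric_growth_Im z) At).
apply: eq_cvg_series => n.
by case: (z ^+ n) => a b; apply/eqP;
  rewrite eq_complex/= !mulr0 subr0 add0r !eqxx.
Qed.

Lemma cvg_complex_solution z t : A t ->
  series (fun n => z ^+ n *: cplx_mx (picard B n t)) @ \oo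
    --> complex_solution z t.
Proof.
move=> At; apply/cvg_mxP => i j.
have := @cvg_complex_solution_entry z t i j At.
apply: cvg_trans; apply: near_eq_cvg; near=> N; rewrite /series/= summxE.
by apply: eq_bigr => n _; rewrite !mxE.
Unshelve. all: by end_near.
Qed.

Lemma complex_solution_holomorphic t i j : A t ->
  holomorphic (fun z => complex_solution z t i j).
Proof.
move=> At z.
have [C C0 hC] := picard_bound T0 cB.
have Ct0 : 0 <= C * t by rewrite mulr_ge0//; move: At;
  rewrite /= in_itv => /andP[].
pose c n : R[i] := (picard B n t i j)%:C.
(* The derived series is needed at the given z only; its coefficients are real, so the real growth
   bound dominates it. *)
have [g hg] : exists g : R[i],
    series (fun n => (z - 0) ^+ n *: deriv_coef c n) @ \oo --> g.
  have [a [b [a0 b0 h]]] : exp_growth (@deriv_coef R R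
    (fun n => picard B n t i j)).
    apply: exp_growth_deriv_coef; exists 1, (C * t); split=> // n.
    by rewrite mul1r; exact: hC.
  pose r := complex.Re `|z|.
  have E : `|z| = r%:C by rewrite /r normc_def.
  apply: (@dominated_series_complex _ _ (fun n => a * exp_coeff (b * r) n)).
    move=> n; rewrite subr0 normrM normrX E.
    have -> : deriv_coef c n = (@deriv_coef R R
      (fun n => picard B n t i j) n)%:C.
      by rewrite /deriv_coef /c rmorphM/= rmorph_nat.
    have -> : `|(@deriv_coef R R (fun n => picard B n t i j) n)%:C| =
      (`|@deriv_coef R R (fun n => picard B n t i j) n|)%:C :> R[i].
      by rewrite normc_def/= expr0n addr0 sqrtr_sqr.
    have r0 : 0 <= r by rewrite -lecR -E; exact: normr_ge0.
    rewrite -rmorphXn -rmorphM lecR.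
    rewrite (_ : a * _ = r ^+ n * (a * exp_coeff b n));
      last by rewrite /exp_coeff/= exprMn; ring.
    by rewrite ler_wpM2l ?exprn_ge0//; exact: h.
  by apply/cvg_ex; exists (a * expR (b * r)); exact: cvg_scaled_exp_series.
have cw w : series (fun n => (w - 0) ^+ n *: c n) @ \oo
  --> complex_solution w t i j.
  have := @cvg_complex_solution_entry w t i j At.
  by apply: eq_cvg_series => n; rewrite subr0.
have bc r : 0 <= r -> exists D : R[i],
    forall N, \sum_(0 <= n < N) `|c n| * r ^+ n <= D.
  move=> r0.
  (* In the order of [R[i]], a nonnegative element is real. *)
  have E : r = (complex.Re r)%:C by move/ger0_Im : r0; case: r => a b /= ->.
  have r0' : 0 <= complex.Re r by rewrite -lecR -E.
  exists ((1 * expR (C * t * complex.Re r))%:C) => N.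
  have -> : \sum_(0 <= n < N) `|c n| * r ^+ n =
     (\sum_(0 <= n < N) `|picard B n t i j| * complex.Re r ^+ n)%:C.
    rewrite rmorph_sum; apply: eq_bigr => n _.
    by rewrite rmorphM rmorphXn/= -E /c normc_def/= expr0n addr0 sqrtr_sqr.
  rewrite lecR.
  apply: le_trans (exp_growth_bound (A := 1) (B := C * t) r0' _ N) _.
    by move=> n; rewrite mul1r; exact: hC.
  by apply: sum_exp_coeff_le => //; exact: mulr_ge0.
have H := @is_derive_power_series R[i] R[i] c
  (fun w => complex_solution w t i j)
  (fun=> g) 0 z bc cw hg.
by case: H.
Qed.

Lemma picard_sum_lin (c c' : R^nat) (a b t : R) : geometric_growth c ->
  geometric_growth c' -> A t ->
  picard_sum B (fun n => a * c n + b * c' n) t =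
    a *: picard_sum B c t + b *: picard_sum B c' t.
Proof.
move=> gc gc' At; apply/matrixP => i j; rewrite [LHS]mxE; apply/cvg_lim => //.
have -> : series (fun n => (a * c n + b * c' n) * picard B n t i j) =
   (fun N => a * series (fun n => c n * picard B n t i j) N +
             b * series (fun n => c' n * picard B n t i j) N).
  apply/funext => N; rewrite /series/= !mulr_sumr -big_split.
  by apply: eq_bigr => n _ /=; ring.
rewrite mxE [X in _ --> X + _]mxE [X in _ --> _ + X]mxE.
by apply: cvgD; apply: cvgMl_tmp; exact: (cvg_picard_sum T0 cB).
Qed.

(** Differentiation in t shifts the coefficients to Re z^(n+1) and Im z^(n+1). Writing z^(n+1) = z
    z^n expresses these through the unshifted ones, and the two real equations recombine into
    multiplication by z. *)
Lemma complex_solution_ode z t : A t ->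
  has_deriv_within (real_complex R) A (complex_solution z) t
    (complex_solution z t *m (z *: cplx_mx (B t))).
Proof.
move=> At.
set P := picard_sum B.
have ReS : P (fun n => complex.Re (z ^+ n.+1)) t =
    complex.Re z *: P (fun n => complex.Re (z ^+ n)) t +
    - complex.Im z *: P (fun n => complex.Im (z ^+ n)) t.
  rewrite -picard_sum_lin//;
    [|exact: geometric_growth_Re|exact: geometric_growth_Im].
  congr (P _ _); apply/funext => n; rewrite exprS; case: z => a b.
  by case: (_ ^+ n) => x y /=; ring.
have ImS : P (fun n => complex.Im (z ^+ n.+1)) t =
    complex.Im z *: P (fun n => complex.Re (z ^+ n)) t +
    complex.Re z *: P (fun n => complex.Im (z ^+ n)) t.
  rewrite -picard_sum_lin//;
    [|exact: geometric_growth_Re|exact: geometric_growth_Im].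
  congr (P _ _); apply/funext => n; rewrite exprS {ReS}; case: z => a b.
  by case: (_ ^+ n) => x y /=; ring.
apply/cvg_mxP => i j.
have -> : (complex_solution z t *m (z *: cplx_mx (B t))) i j =
    ((P (fun n => complex.Re (z ^+ n.+1)) t *m B t) i j +i*
     (P (fun n => complex.Im (z ^+ n.+1)) t *m B t) i j).
  rewrite ReS ImS -scalemxAr scalemxAl !mxE.
  under eq_bigr do rewrite !mxE.
  under [X in _ = X +i* _]eq_bigr do rewrite !mxE.
  under [X in _ = _ +i* X]eq_bigr do rewrite !mxE.
  elim/big_ind3 : _ => [//|x1 x2 x3 y1 y2 y3 -> -> //|l _].
  by case: z {ReS ImS} => a b; apply/eqP; rewrite eq_complex/=; apply/andP;
    split; apply/eqP; ring.
have E s : complex.Complex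
    (id (s - t)^-1 *: (P (fun n => complex.Re (z ^+ n)) s i j -
      P (fun n => complex.Re (z ^+ n)) t i j))
    (id (s - t)^-1 *: (P (fun n => complex.Im (z ^+ n)) s i j -
      P (fun n => complex.Im (z ^+ n)) t i j)) =
    (real_complex R (s - t)^-1 *: (complex_solution z s - complex_solution z t))
      i j.
  rewrite /P !mxE; apply/eqP; rewrite eq_complex/= /GRing.scale/=.
  by apply/andP; split; apply/eqP; ring.
rewrite -(eq_cvg _ _ E).
exact: cvg_complex
  (picard_sum_has_deriv_within T0 cB (geometric_growth_Re z) At)
  (picard_sum_has_deriv_within T0 cB (geometric_growth_Im z) At).
Qed.

Lemma complex_solution0 z : complex_solution z 0 = 1%:M.
Proof.
apply/matrixP => i j; rewrite mxE !picard_sum0 expr0 !mxE/=.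
by case: (i == j); rewrite ?mulr0n ?mulr1n.
Qed.

(** At a real parameter the powers have no imaginary part, and the real series is the one of the
    given solution. *)
Lemma complex_solution_real lam t (Z : 'M[R]_k) :
  (forall i j, series (fun n => lam ^+ n * picard B n t i j) @ \oo --> Z i j) ->
  complex_solution lam%:C t = cplx_mx Z.
Proof.
move=> h; apply/matrixP => i j; rewrite !mxE.
have -> : limn (series (fun n => complex.Re (lam%:C ^+ n) * picard B n t i j)) =
  Z i j.
  by under eq_fun do rewrite -rmorphXn/=; exact/cvg_lim.
congr (_ +i* _); apply/cvg_lim => //.
have -> : series (fun n => complex.Im (lam%:C ^+ n) * picard B n t i j) = cst 0.
  by apply/funext => N; rewrite /series/= big1// => n _;
    rewrite -rmorphXn mul0r.
exact: cvg_cst.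
Qed.

End ComplexExtension.

(** * Signature expansion, orthogonality and entire extension of the solution *)

Theorem theorem3p1 (R : realType) (d k : nat) (T : R) (X : R -> 'rV[R]_d)
    (M : {linear 'rV[R]_d -> 'M[R]_k}) (Y : R -> R -> 'M[R]_k)
    (T_gt0 : 0 < T) (k_ge1 : (1 <= k)%N)
    (X_smooth : smooth_on `[0, T] X)
    (M_so : forall x, so_mx (M x))
    (Y_init : forall lam, Y lam 0 = 1%:M)
    (Y_ode : forall lam t, 0 <= t <= T ->
      has_deriv_within id `[0, T] (Y lam) t
        (Y lam t *m (lam \*: M) (deriv_within `[0, T] X t))) :
  let MC : 'rV[R]_d -> 'M[R[i]]_k := fun x => cplx_mx (M x) in
  let S : R -> tensor_seq R d := signature T X in
  [/\ (* (1) *)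
      forall (lam t : R), 0 <= t <= T ->
        [/\ series (fun n => tensor_map (lam%:C \*: MC) (S t n)) @ \oo
              --> cplx_mx (Y lam t),
            cplx_mx (Y lam t) = tilde (lam%:C \*: MC) (S t),
            series (fun n => lam%:C ^+ n *: tensor_map MC (S t n)) @ \oo
              --> cplx_mx (Y lam t)
          & cplx_mx (Y lam t) = development T X t (lam%:C \*: MC)],
      (* (2) *)
      forall (lam t : R), 0 <= t <= T -> orthogonal_mx (Y lam t)
    & (* (3) *)
      [/\ forall t : R, 0 <= t <= T ->
            forall i j, real_analytic (fun lam => Y lam t i j),
          exists Yext : R[i] -> R -> 'M[R[i]]_k,
            [/\ forall (lam t : R), 0 <= t <= T ->
                  Yext lam%:C t = cplx_mx (Y lam t),
                forall t : R, 0 <= t <= T ->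
                  forall i j, holomorphic (fun z => Yext z t i j),
                forall (z : R[i]) (t : R), 0 <= t <= T ->
                  [/\ series (fun n => z ^+ n *: tensor_map MC (S t n)) @ \oo
                        --> Yext z t,
                      series (fun n => tensor_map (z \*: MC) (S t n)) @ \oo
                        --> Yext z t
                    & Yext z t = tilde (z \*: MC) (S t)]
              & forall z : R[i], Yext z 0 = 1%:M /\
                  forall t : R, 0 <= t <= T ->
                    has_deriv_within (real_complex R) `[0, T] (Yext z) t
                      (Yext z t *m (z \*: MC) (deriv_within `[0, T] X t))]
        & forall (n : nat) (lam t : R), (1 <= n)%N -> 0 <= t <= T ->
            derivable (derive1n n.-1 (fun l => Y l t)) lam 1 /\
            derive1n n (fun l => Y l t) lam =
              n`!%:R *: (simplex_int_mx t (fun s : n.-tuple R =>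
                  \mxprod_(u <- s) Ad (Y lam u) (M (deriv_within `[0, T] X u)))
                *m Y lam t)]].
Proof.
move=> MC S.
have T0 : 0 <= T := ltW T_gt0.
have inA t : 0 <= t <= T -> `[0, T]%classic t by rewrite /= in_itv.
have ode lam t (At : `[0, T]%classic t) : has_deriv_within id `[0, T] (Y lam) t
    (Y lam t *m (lam *: M (deriv_within `[0, T] X t))).
  by apply: Y_ode; move: At; rewrite /= in_itv.
pose B t := M (deriv_within `[0, T] X t).
have cB i j : cont_on T (fun t => B t i j) by exact: driver_cont.
have SE n t : `[0, T]%classic t ->
  tensor_map MC (S t n) = cplx_mx (picard B n t).
  by move=> At; exact: tensor_map_signature.
have cvgE z t : `[0, T]%classic t ->
    series (fun n => z ^+ n *: tensor_map MC (S t n)) @ \oo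
      --> complex_solution B z t.
  move=> At; have := @cvg_complex_solution _ _ _ _ T0 cB z t At.
  by apply: eq_cvg_series => n; rewrite SE.
have cvgZ z t : `[0, T]%classic t ->
    series (fun n => tensor_map (z \*: MC) (S t n)) @ \oo
      --> complex_solution B z t.
  move=> At; have := @cvgE z t At.
  by apply: eq_cvg_series => n; rewrite tensor_mapZ.
have tildeE z t : `[0, T]%classic t ->
  complex_solution B z t = tilde (z \*: MC) (S t).
  by move=> At; apply/esym/cvg_lim; [exact: norm_hausdorff|exact: cvgZ].
have YE lam t : `[0, T]%classic t -> complex_solution B lam%:C t =
  cplx_mx (Y lam t).
  move=> At; apply: complex_solution_real => i j.
  exact: (cvg_solution T0 X_smooth Y_init ode).
split.
(* The real expansions are the complex ones taken at z = lam. *)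
- move=> lam t /inA At; rewrite -YE//; split.
  + exact: cvgZ.
  + exact: tildeE.
  + exact: cvgE.
  + exact: tildeE.
- move=> lam t /inA At.
  exact: (solution_tr_mulmx T0 M_so Y_init ode).
- split.
  + by move=> t /inA At i j; exact:
    (solution_real_analytic T0 X_smooth M_so Y_init ode).
  + exists (complex_solution B); split.
    * by move=> lam t /inA At; exact: YE.
    * by move=> t /inA At i j; exact: (complex_solution_holomorphic T0 cB).
    * by move=> z t /inA At; split; [exact: cvgE|exact: cvgZ|exact: tildeE].
    * move=> z; split; first exact: complex_solution0.
      by move=> t /inA At; exact: (complex_solution_ode T0 cB).
  + move=> n lam t n1 /inA At.
    have [_ E] := solution_derive1n T0 X_smooth M_so Y_init ode lam n At.
    (* Existence of the n-th derivative is differentiability of the one of order n - 1. *)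
    split; first by have [] := solution_derive1n T0 X_smooth M_so Y_init ode lam
      n.-1 At.
    rewrite E (simplex_int_mx_mxprod T0)//.
    by move=> i j; exact: (Ad_solution_cont T0 X_smooth M_so Y_init ode).
Qed.
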